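(* Let $S\subset\{1,\dots,n\}$ be a subset such that $a_{i,j}=0$ for each pair $(i,j)$ with $i\neq j$ and $i,j\in S$. Put $Q_S^+=\{\sum_{j=1}^n b_j\alpha_j\in Q^+ \mid b_i=0 \text{ for all } i\notin S\}$, $(Q_S^+)^c=Q^+\setminus Q_S^+$, and consider the decomposition $$U_0=U_0^S\oplus I^S,\qquad U_0^S=\bigoplus_{\gamma\in Q_S^+}U_{0,\gamma},\qquad I^S=\bigoplus_{\gamma\in (Q_S^+)^c}U_{0,\gamma}.$$ Then $U_0^S$ is a commutative subalgebra of $U_0$, generated by $E_iF_i$ ($i\in S$) and $K_j^{\pm1}$ ($1\le j\le n$), and the subspace $I^S$ is a two-sided ideal of $U_0$.
   Context: Let $\mathfrak g$ be a complex semisimple Lie algebra of rank $n$ with Cartan subalgebra $\mathfrak h$, simple roots $\alpha_1,\dots,\alpha_n$, Cartan matrix $(a_{i,j})$, and $D=\mathrm{diag}(d_1,\dots,d_n)$, $d_i\in\{1,2,3\}$, with $(d_ia_{i,j})$ symmetric positive definite; $(\cdot,\cdot)$ is the bilinear form on $\mathfrak h^*$ with $(\alpha_i,\alpha_j)=d_ia_{i,j}$. $Q=\bigoplus_i\mathbb Z\alpha_i$, $Q^+=\bigoplus_i\mathbb N_0\alpha_i$, $\mathbb N_0=\{0,1,2,\dots\}$. $q\in\mathbb C\setminus\{0\}$ is not a root of unity, $q_i=q^{d_i}$. $U=U_q(\mathfrak g)$ is the unital associative $\mathbb C$-algebra generated by $E_i,F_i,K_i,K_i^{-1}$ ($1\le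 i\le n$) with relations $K_iK_i^{-1}=1=K_i^{-1}K_i$, $K_iK_j=K_jK_i$, $K_iE_jK_i^{-1}=q_i^{a_{i,j}}E_j$, $K_iF_jK_i^{-1}=q_i^{-a_{i,j}}F_j$, $E_iF_j-F_jE_i=\delta_{i,j}\frac{K_i-K_i^{-1}}{q_i-q_i^{-1}}$, and for $i\ne j$ the quantum Serre relations $\sum_{r=0}^{1-a_{i,j}}(-1)^r\binom{1-a_{i,j}}{r}_{q_i}X_i^{1-a_{i,j}-r}X_jX_i^r=0$ for $X=E$ and $X=F$, where $\binom{m}{r}_q=\frac{[m]_q!}{[r]_q![m-r]_q!}$, $[k]_q!=\prod_{j=1}^k[j]_q$, $[j]_q=\frac{q^j-q^{-j}}{q-q^{-1}}$. $U^+$, $U^-$, $U^0$ are the subalgebras generated by the $E_i$, the $F_i$, the $K_i^{\pm1}$ respectively. For $\gamma\in Q$, $U_\gamma=\{X\in U\mid K_iXK_i^{-1}=q^{(\alpha_i,\gamma)}X\ \forall i\}$ and $U^\pm_\gamma=U^\pm\cap U_\gamma$. $U_0$ (the case $\gamma=0$) is the centralizer of $U^0$ in $U$. For $\gamma\in Q^+$, $U_{0,\gamma}=U^+_\gamma U^0U^-_{-\gamma}$; one has $U_0=\bigoplus_{\gamma\in Q^+}U_{0,\gamma}$. *)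

(* Defs.v *)
From HB Require Import structures.
From mathcomp Require Import all_boot all_order all_algebra.
From mathcomp Require Import all_classical all_reals.
From mathcomp Require Export complex.

Set Implicit Arguments.
Unset Strict Implicit.
Unset Printing Implicit Defensive.

Import Order.TTheory GRing.Theory Num.Theory.

Local Open Scope classical_set_scope.
Local Open Scope ring_scope.

Section QuantumIntegers.
Variables (C : fieldType) (q : C).

Definition qint (j : nat) : C := (q ^+ j - q ^- j) / (q - q^-1).
Definition qfact (k : nat) : C := \prod_(1 <= j < k.+1) qint j.
Definition qbinom (m r : nat) : C := qfact m / (qfact r * qfact (m - r)%N).

End QuantumIntegers.

Section RootData.
Variables (n : nat) (a : 'M[int]_n) (d : 'I_n -> nat).

Definition sym_cartan : 'M[int]_n := \matrix_(i, j) ((d i)%:Z * a i j).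

Definition posdefmx (R : realType) (B : 'M[R]_n) : Prop :=
  B^T = B /\ forall x : 'rV[R]_n, x != 0 -> 0 < (x *m B *m x^T) 0 0.

(* The pairs (a, D) with a the Cartan matrix of a complex semisimple Lie      *)
(* algebra of rank n (positive definiteness makes a of finite type) and D a   *)
(* symmetrizing diagonal matrix with entries in {1, 2, 3}.                    *)
Record cartan_datum (R : realType) : Prop := CartanDatum {
  cartan_diag : forall i, a i i = 2;
  cartan_offdiag : forall i j, i != j -> a i j <= 0;
  cartan_zero : forall i j, a i j = 0 -> a j i = 0;
  cartan_d : forall i, d i \in [:: 1; 2; 3]%N;
  cartan_posdef : posdefmx (map_mx (intr : int -> R) sym_cartan) }.

(* The root lattice Q is 'rV[int]_n, in the basis of simple roots.            *)
Definition simple_root (i : 'I_n) : 'rV[int]_n := delta_mx 0 i.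
Definition root_form (x y : 'rV[int]_n) : int := (x *m sym_cartan *m y^T) 0 0.

Definition Qplus : set 'rV[int]_n := [set g | forall i, 0 <= g 0 i].
Definition QplusS (S : {set 'I_n}) : set 'rV[int]_n :=
  [set g | Qplus g /\ forall i, i \notin S -> g 0 i = 0].

End RootData.

(* Possibly infinite-dimensional subspaces are represented as sets; note that *)
(* membership in mem A is membership in A, through in_setE.                   *)
Section Subspaces.
Variables (C : fieldType) (U : algType C).

Definition lspan (A : set U) : set U :=
  smallest (fun V : set U => GRing.submod_closed (mem V)) A.

Definition subalg_gen (A : set U) : set U :=
  smallest (fun V : set U => GRing.subalg_closed (mem V)) A.

Definition prodsp (A B : set U) : set U := lspan [set x * y | x in A & y in B].

Definition sumsp (I : Type) (P : set I) (V : I -> set U) : set U :=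
  lspan (\bigcup_(i in P) V i).

Definition direct (I : choiceType) (P : set I) (V : I -> set U) : Prop :=
  forall (s : seq I) (x : I -> U), uniq s ->
    (forall i, i \in s -> P i /\ V i (x i)) ->
    \sum_(i <- s) x i = 0 -> forall i, i \in s -> x i = 0.

Definition direct_sum2 (W A B : set U) : Prop :=
  W = lspan (A `|` B) /\ A `&` B = [set 0].

Definition subalgebra_of (W A : set U) : Prop :=
  A `<=` W /\ GRing.subalg_closed (mem A).

Definition two_sided_ideal_of (W I : set U) : Prop :=
  [/\ I `<=` W, GRing.submod_closed (mem I)
    & forall w x, W w -> I x -> I (w * x) /\ I (x * w)].

End Subspaces.

Section QuantumGroup.
Variables (C : fieldType) (n : nat) (a : 'M[int]_n) (d : 'I_n -> nat) (q : C).

Let qi (i : 'I_n) : C := q ^+ d i.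

Definition serre_rel (A : algType C) (X : 'I_n -> A) (i j : 'I_n) : Prop :=
  let m := `|1 - a i j|%N in
  \sum_(r < m.+1) ((-1) ^+ r * qbinom (qi i) m r)
                    *: (X i ^+ (m - r) * X j * X i ^+ r) = 0.

(* K' i stands for the generator K_i^{-1}. *)
Record Uq_relations (A : algType C) (E F K K' : 'I_n -> A) : Prop :=
  UqRelations {
    Uq_KV : forall i, K i * K' i = 1 /\ K' i * K i = 1;
    Uq_KK : forall i j, K i * K j = K j * K i;
    Uq_KE : forall i j, K i * E j * K' i = (qi i ^ a i j) *: E j;
    Uq_KF : forall i j, K i * F j * K' i = (qi i ^ (- a i j)) *: F j;
    Uq_EF : forall i j, E i * F j - F j * E i =
      if i == j then (qi i - (qi i)^-1)^-1 *: (K i - K' i) else 0;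
    Uq_serreE : forall i j, i != j -> serre_rel E i j;
    Uq_serreF : forall i j, i != j -> serre_rel F i j }.

(* U, with its elements E i, F i, K i, K' i, is the algebra presented by      *)
(* these generators and relations: the relations hold in U, and U is          *)
(* universal for them.                                                        *)
Record is_Uq (U : algType C) (E F K K' : 'I_n -> U) : Prop := IsUq {
  Uq_rel : Uq_relations E F K K';
  Uq_lift : forall (A : algType C) (E1 F1 K1 K1' : 'I_n -> A),
    Uq_relations E1 F1 K1 K1' ->
    exists phi : {lrmorphism U -> A}, forall i,
      [/\ phi (E i) = E1 i, phi (F i) = F1 i,
          phi (K i) = K1 i & phi (K' i) = K1' i];
  Uq_lift_uniq : forall (A : algType C) (phi psi : {lrmorphism U -> A}),
    (forall i, [/\ phi (E i) = psi (E i), phi (F i) = psi (F i),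
                   phi (K i) = psi (K i) & phi (K' i) = psi (K' i)]) ->
    phi =1 psi }.

Variables (U : algType C) (E F K K' : 'I_n -> U).

Definition Upos : set U := subalg_gen (range E).
Definition Uneg : set U := subalg_gen (range F).
Definition Ucartan : set U := subalg_gen (range K `|` range K').

Definition Uweight (g : 'rV[int]_n) : set U :=
  [set x | forall i,
     K i * x * K' i = (q ^ root_form a d (simple_root i) g) *: x].

(* U_{0,g} = U^+_g U^0 U^-_{-g} *)
Definition Uzero (g : 'rV[int]_n) : set U :=
  prodsp (prodsp (Upos `&` Uweight g) Ucartan) (Uneg `&` Uweight (- g)).

Definition UzeroS (S : {set 'I_n}) : set U := sumsp (QplusS S) Uzero.

Definition IdealS (S : {set 'I_n}) : set U :=
  sumsp (@Qplus n `\` QplusS S) Uzero.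

End QuantumGroup.

(* Main.v *)
Require Import Defs.
From HB Require Import structures.
From mathcomp Require Import all_boot all_order all_algebra.
From mathcomp Require Import all_classical all_reals.
From mathcomp Require Import ring zify.

Set Implicit Arguments.
Unset Strict Implicit.
Unset Printing Implicit Defensive.

Import Order.TTheory GRing.Theory Num.Theory.

Local Open Scope classical_set_scope.
Local Open Scope ring_scope.

(** Write [E_v u F_w] for a triangular monomial, with [v] and [w] words in the
    simple roots and [u] in [U^0]. The cross relations show that these monomials
    span [U] ([tri_all]). Each is a weight vector, and as [q] is not a root of unity
    and the form on the root lattice is nondegenerate, distinct weights are
    linearly independent ([weight_sep]). Hence [U_0] is spanned by the monomials
    in which [v] and [w] have the same degree [g], and those of degree [g] span
    [U_{0,g}] ([Uzero_tri], [weight0_tri]).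

    The hard point is that the [U_{0,g}] are independent. If the triangular
    decomposition of [U] is known, there is a linear projection of [U] that keeps
    the monomials [E_v u F_w] with [w] of degree [g] and kills the others, and
    conversely such projections give independence. They are constructed here
    without the triangular decomposition, as matrix coefficients of a coinduced
    representation. Let [N] be the algebra generated by the [F_i] subject to the
    Serre relations. If [U] is a free left module over the subalgebra generated by
    the [E_i] and [U^0], on a basis of [N], then right multiplication in [U]
    dictates how [U] acts on [U]-valued linear functions on [N]. These formulas
    make sense without any knowledge of [U]: [F_i] acts by translation, [K_i] by
    rescaling and multiplication, and [E_i] is determined by recursion on the
    length of the word. Functions on [N] are functions on words that vanish on the
    Serre elements. Verifying the relations reduces to one computation, that the
    Serre elements in the [E_i] commute with the [F_k] in the algebra without Serre
    relations, and the same with [E] and [F] interchanged ([serre_comm]); the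
    coefficients that remain cancel by an alternating sum of quantum binomials.
    Acting on the function equal to [F_w] on words of degree [g] and to zero on
    other words, and evaluating at the empty word, is the projection sought
    ([triangular_projection]).

    The multiplicative statements come from reordering [F_w E_v], which lowers
    both degrees by a common element of [Q^+]: the product of [U_{0,g}] and
    [U_{0,h}] lies in the sum of the [U_{0,k}] with [g <= k], [h <= k] and
    [k <= g + h] ([tri_mul]). The upper bound makes [U_0^S] a subalgebra, the lower
    bounds make [I^S] an ideal. When the simple roots in [S] are orthogonal, the
    [E_i] for [i] in [S] commute, as do the [F_i]; then in a monomial of degree in
    [Q_S^+] the outermost [E_i] can be paired with an [F_i], which shows by
    induction that it lies in the algebra generated by the [E_i F_i] and [U^0]
    ([mon_EFK]). The generators of this algebra commute with each other. *)

(** * The algebra of endomorphisms of a nonzero module *)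

Section Endomorphisms.
Variables (C : fieldType) (V : lmodType C).

Definition islin : {pred V -> V} := fun f => `[< linear f >].

Lemma islinP f : reflect (linear f) (f \in islin).
Proof. exact: asboolP. Qed.

Lemma islin_submod : submod_closed islin.
Proof.
split; first by apply/islinP => c x y; rewrite /= scaler0 addr0.
move=> a f g /islinP lf /islinP lg; apply/islinP => c x y.
have addE x' : (a *: f + g) x' = a *: f x' + g x' by [].
rewrite !addE lf lg !scalerDr !scalerA mulrC -!addrA; congr (_ + _).
by rewrite addrCA.
Qed.

HB.instance Definition _ := GRing.isSubmodClosed.Build C (V -> V) islin
  islin_submod.

(** The proof that [v] is nonzero is a parameter of the type, so that the
    nontrivial ring structure of the endomorphisms can be attached to it. *)
Record lend (v : V) (v_neq0 : v != 0) :=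
  Lend { lfun :> V -> V; lfun_lin : lfun \in islin }.

Variables (v : V) (v_neq0 : v != 0).
Local Notation L := (lend v_neq0).

HB.instance Definition _ := [isSub for @lfun v v_neq0].
HB.instance Definition _ := [Choice of L by <:].
HB.instance Definition _ := [SubChoice_isSubLmodule of L by <:].

Lemma lendP (f g : L) : (f : V -> V) =1 g -> f = g.
Proof. by move=> fg; apply/val_inj/funext. Qed.

Definition mkl (f : V -> V) (lf : linear f) : L :=
  Lend v_neq0 (introT (islinP f) lf).

Lemma lend_linear (f : L) : linear f.
Proof. by have /islinP := lfun_lin f. Qed.

Lemma lend_scale (f : L) c x : f (c *: x) = c *: f x.
Proof. exact: (scalable_linear (lend_linear f)). Qed.

Lemma lend0 (f : L) : f 0 = 0.
Proof. by have := lend_scale f 0 0; rewrite !scale0r. Qed.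

Lemma id_linear : linear (@id V). Proof. by []. Qed.
Lemma comp_linear (f g : L) : linear (f \o g).
Proof. by move=> c x y /=; rewrite !lend_linear. Qed.

Definition lone := mkl id_linear.
Definition lmul (f g : L) := mkl (comp_linear f g).

Lemma lmulA : associative lmul. Proof. by move=> f g h; apply: lendP. Qed.
Lemma lmul1 : left_id lone lmul. Proof. by move=> f; apply: lendP. Qed.
Lemma lmulr1 : right_id lone lmul. Proof. by move=> f; apply: lendP. Qed.
Lemma lmulDl : left_distributive lmul +%R.
Proof. by move=> f g h; apply: lendP. Qed.
Lemma lmulDr : right_distributive lmul +%R.
Proof.
move=> f g h; apply: lendP => x /=.
by have := lend_linear f 1 (g x) (h x); rewrite !scale1r.
Qed.
Lemma lone_neq0 : lone != 0.
Proof.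
by apply: contraNneq v_neq0 => /(congr1 (fun f : L => f v)) /= ->.
Qed.

HB.instance Definition _ := GRing.Zmodule_isNzRing.Build L
  lmulA lmul1 lmulr1 lmulDl lmulDr lone_neq0.

Lemma lscaleAl (c : C) (f g : L) : c *: (f * g) = (c *: f) * g.
Proof. by apply: lendP. Qed.
HB.instance Definition _ := GRing.Lmodule_isLalgebra.Build C L lscaleAl.

Lemma lscaleAr (c : C) (f g : L) : c *: (f * g) = f * (c *: g).
Proof.
apply: lendP => x.
by rewrite /= lend_scale.
Qed.
HB.instance Definition _ := GRing.Lalgebra_isAlgebra.Build C L lscaleAr.

Lemma lendZ (c : C) (f : L) x : (c *: f) x = c *: f x. Proof. by []. Qed.
Lemma lendM (f g : L) x : (f * g) x = f (g x). Proof. by []. Qed.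
Lemma lend_sum (I : Type) (r : seq I) (P : pred I) (f : I -> L) x :
  (\sum_(i <- r | P i) f i) x = \sum_(i <- r | P i) f i x.
Proof. by elim/big_rec2: _ => // i y g _ <-. Qed.
Lemma lendX (f : L) k x : (f ^+ k) x = iter k f x.
Proof. by elim: k => // k IH; rewrite exprS lendM IH. Qed.

End Endomorphisms.
(** * Quantum binomials *)

Section QuantumBinomials.
Variables (C : fieldType) (k : C).
Hypotheses (k_neq0 : k != 0) (k_not_root : forall m, (0 < m)%N -> k ^+ m != 1).

Lemma qdenom_neq0 : k - k^-1 != 0.
Proof.
rewrite subr_eq0; apply: contra (k_not_root (isT : (0 < 2)%N)) => /eqP kk.
by rewrite expr2 {1}kk mulVf.
Qed.

Lemma qint_neq0 j : (0 < j)%N -> qint k j != 0.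
Proof.
move=> j0; rewrite /qint mulf_neq0 ?invr_eq0 ?qdenom_neq0 //.
have jj0 : (0 < j + j)%N by rewrite addn_gt0 j0.
rewrite subr_eq0; apply: contra (k_not_root jj0) => /eqP kk.
by rewrite exprD {1}kk mulVf // expf_neq0.
Qed.

Lemma qfact0 : qfact k 0 = 1. Proof. by rewrite /qfact big_nil. Qed.

Lemma qfactS m : qfact k m.+1 = qfact k m * qint k m.+1.
Proof. by rewrite /qfact big_nat_recr. Qed.

Lemma qfact_neq0 m : qfact k m != 0.
Proof.
elim: m => [|m IH]; first by rewrite qfact0 oner_neq0.
by rewrite qfactS mulf_neq0 // qint_neq0.
Qed.

Lemma qbinom0 m : qbinom k m 0 = 1.
Proof. by rewrite /qbinom qfact0 subn0 mul1r divff // qfact_neq0. Qed.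

Lemma qbinomnn m : qbinom k m m = 1.
Proof. by rewrite /qbinom subnn qfact0 mulr1 divff // qfact_neq0. Qed.

Lemma qbinom_shift m r : (r <= m)%N ->
  qbinom k m.+1 r * qint k (m - r).+1 = qbinom k m.+1 r.+1 * qint k r.+1.
Proof.
move=> rm; rewrite /qbinom subSS subSn // !qfactS.
by field; rewrite !qint_neq0 // !qfact_neq0.
Qed.

(** The rule fails at the ends, because the quotient of factorials defining
    [qbinom k m r] does not vanish for [m < r]. *)
Lemma qbinom_pascal m r : (r < m)%N ->
  qbinom k m.+1 r.+1 =
    qbinom k m r.+1 * k ^- r.+1 + qbinom k m r * k ^+ (m - r).
Proof.
move=> rm; have [j ->] : exists j, m = (r + j).+1.
  by exists (m - r.+1)%N; lia.
rewrite /qbinom; have -> : ((r + j).+1 - r = j.+1)%N by lia.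
have [-> ->] : ((r + j).+2 - r.+1 = j.+1 /\ (r + j).+1 - r.+1 = j)%N by lia.
rewrite !qfactS.
have key : qint k (r + j).+2 =
    qint k j.+1 * k ^- r.+1 + qint k r.+1 * k ^+ j.+1.
  have -> : ((r + j).+2 = r.+1 + j.+1)%N by rewrite addSn addnS.
  rewrite /qint exprD.
  have kk1 : k * k - 1 != 0 by rewrite subr_eq0 -expr2 k_not_root.
  by field; rewrite k_neq0 kk1 !expf_neq0.
rewrite key; field.
by rewrite !expf_neq0 // !qfact_neq0 !qint_neq0.
Qed.

(** The partial sums telescope: by Pascal's rule the sum of the terms of index
    at most [r] is [(-1) ^+ r * qbinom k m r * k ^- (m.+1 * r)]. *)
Lemma qbinom_altsum m :
  \sum_(r < m.+2) (-1) ^+ r * qbinom k m.+1 r * (k ^- m) ^+ r = 0.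
Proof.
have part r : (r <= m)%N ->
    \sum_(t < r.+1) (-1) ^+ t * qbinom k m.+1 t * (k ^- m) ^+ t =
      (-1) ^+ r * qbinom k m r * (k ^- m.+1) ^+ r.
  elim: r => [|r IH] rm; first by rewrite big_ord1 !qbinom0 !mul1r.
  rewrite big_ord_recr /= IH ?(ltnW rm) // qbinom_pascal //.
  have -> : k ^+ (m - r) = k ^+ m * k ^- r by rewrite expfB.
  rewrite !exprVn -!exprM !mulSn !mulnS !exprD !exprS.
  by field; rewrite !expf_neq0 // k_neq0 !expf_neq0.
rewrite big_ord_recr /= part // !qbinomnn !mulr1 -!exprVn -!exprM.
by rewrite mulnC exprS mulN1r mulNr addrN.
Qed.

End QuantumBinomials.

(** Quantum integers are invariant under [k |-> k^-1], which exchanges the two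
    alternating sums. *)
Lemma qint_inv (C : fieldType) (k : C) j : qint k^-1 j = qint k j.
Proof.
rewrite /qint invrK !exprVn.
by rewrite invrK -opprB -(opprB k) invrN mulrNN.
Qed.

Lemma qbinom_inv (C : fieldType) (k : C) m r : qbinom k^-1 m r = qbinom k m r.
Proof.
have fI t : qfact k^-1 t = qfact k t.
  by rewrite /qfact; apply: eq_bigr => j _; rewrite qint_inv.
by rewrite /qbinom !fI.
Qed.

Lemma qbinom_altsumV (C : fieldType) (k : C) (k_neq0 : k != 0)
    (k_not_root : forall m, (0 < m)%N -> k ^+ m != 1) m :
  \sum_(r < m.+2) (-1) ^+ r * qbinom k m.+1 r * (k ^+ m) ^+ r = 0.
Proof.
rewrite -[RHS](@qbinom_altsum _ k^-1 _ _ m) ?invr_eq0 //.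
  by apply: eq_bigr => r _; rewrite qbinom_inv (exprVn k m) invrK.
by move=> j j0; rewrite exprVn invr_eq1 k_not_root.
Qed.
(** * Quantum Serre elements commute with the opposite generators *)

Section NonSerre.
Variables (C : fieldType) (n : nat) (a : 'M[int]_n) (d : 'I_n -> nat) (q : C).

Local Notation qi i := (q ^+ d i).

(** The Serre relations are left out because what makes them hold in the
    representation below is a property of the Serre elements in an algebra where
    they need not vanish. *)
Record nonserre_relations (A : algType C) (E F K K' : 'I_n -> A) : Prop :=
  NonserreRelations {
    ns_KV : forall i, K i * K' i = 1 /\ K' i * K i = 1;
    ns_KK : forall i j, K i * K j = K j * K i;
    ns_KE : forall i j, K i * E j * K' i = (qi i ^ a i j) *: E j;
    ns_KF : forall i j, K i * F j * K' i = (qi i ^ (- a i j)) *: F j;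
    ns_EF : forall i j, E i * F j - F j * E i =
      if i == j then (qi i - (qi i)^-1)^-1 *: (K i - K' i) else 0 }.

Definition serre_elt (A : algType C) (X : 'I_n -> A) (i j : 'I_n) : A :=
  \sum_(r < `|1 - a i j|.+1)
    ((-1) ^+ r * qbinom (qi i) `|1 - a i j| r)
      *: (X i ^+ (`|1 - a i j| - r) * X j * X i ^+ r).

Hypotheses (q_neq0 : q != 0)
  (q_not_root : forall m : nat, (0 < m)%N -> q ^+ m != 1).
Hypotheses (a_diag : forall i, a i i = 2)
  (a_offdiag : forall i j, i != j -> a i j <= 0)
  (d_gt0 : forall i, (0 < d i)%N)
  (a_sym : forall i j, (d i)%:Z * a i j = (d j)%:Z * a j i).

Lemma qi_neq0 i : qi i != 0. Proof. exact: expf_neq0. Qed.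

Lemma qi_not_root i m : (0 < m)%N -> qi i ^+ m != 1.
Proof. by move=> m0; rewrite -exprM q_not_root // muln_gt0 d_gt0. Qed.

Lemma qiz_sym i j : qi i ^ a i j = qi j ^ a j i.
Proof. by rewrite !exprnP !exprz_exp a_sym. Qed.

Section Algebra.
Variables (A : algType C) (E F K K' : 'I_n -> A).

(** This symmetry gives each statement about the [E i] also for the [F i]. *)
Lemma nonserre_swap : nonserre_relations E F K K' -> nonserre_relations F E K' K.
Proof.
case=> KV KK KE KF EF.
have K'x i (x : A) c : c != 0 -> K i * x * K' i = c *: x ->
    K' i * x * K i = c^-1 *: x.
  have [KK1 KK2] := KV i; move=> c0 Kx.
  rewrite -[x in LHS](scale1r x) -(mulVf c0) -scalerA -Kx.
  by rewrite -scalerAr -scalerAl !mulrA KK2 mul1r -mulrA KK2 mulr1.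
split.
- by move=> i; have [] := KV i.
- move=> i j; have [Ki1 Ki2] := KV i; have [Kj1 Kj2] := KV j.
  have e1 : K' i * K' j * (K j * K i) = 1.
    by rewrite !mulrA -(mulrA (K' i)) Kj2 mulr1 Ki2.
  have e2 : (K i * K j) * (K' j * K' i) = 1.
    by rewrite !mulrA -(mulrA (K i)) Kj1 mulr1 Ki1.
  by rewrite -[LHS]mulr1 -e2 KK mulrA e1 mul1r.
- move=> i j; rewrite (K'x _ _ _ _ (KF i j)) ?expfz_neq0 ?qi_neq0 //.
  by rewrite invr_expz opprK.
- move=> i j; rewrite (K'x _ _ _ _ (KE i j)) ?expfz_neq0 ?qi_neq0 //.
  by rewrite invr_expz.
- move=> i j; rewrite -opprB EF eq_sym; case: eqP => [->|_]; last by rewrite oppr0.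
  by rewrite -scalerN opprB.
Qed.

Hypothesis rel : nonserre_relations E F K K'.

Lemma ns_KK' i j : K i * K' j = K' j * K i.
Proof.
have [Kj1 Kj2] := ns_KV rel j.
rewrite -[LHS]mul1r -Kj2 -(mulrA (K' j)) (mulrA (K j)) -(ns_KK rel).
by rewrite -(mulrA (K i)) Kj1 mulr1.
Qed.

Lemma ns_KE_comm i j : K i * E j = (qi i ^ a i j) *: (E j * K i).
Proof.
have [KK1 KK2] := ns_KV rel i.
by rewrite scalerAl -(ns_KE rel) -(mulrA (K i * E j)) KK2 mulr1.
Qed.

Lemma ns_K'E_comm i j : K' i * E j = (qi i ^ (- a i j)) *: (E j * K' i).
Proof.
have [KK1 KK2] := ns_KV rel i.
have q0 : qi i ^ a i j != 0 by rewrite expfz_neq0 // qi_neq0.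
rewrite -invr_expz; apply: (scalerI q0); rewrite scalerA divff // scale1r.
by rewrite scalerAr -(ns_KE rel) !mulrA KK2 mul1r.
Qed.

(** For [x = qi i ^+ t] this is the element [[K_i; t]] of Lusztig. *)
Definition kbracket i (x : C) : A :=
  (qi i - (qi i)^-1)^-1 *: (x *: K i - x^-1 *: K' i).

Lemma hE i j x : x != 0 -> kbracket i x * E j = E j * kbracket i (x * (qi i ^ a i j)).
Proof.
move=> x0; rewrite /kbracket -scalerAl -scalerAr; congr (_ *: _).
rewrite mulrBl mulrBr -!scalerAl -!scalerAr ns_KE_comm ns_K'E_comm.
by rewrite !scalerA invfM invr_expz.
Qed.

Lemma hEX i j x r : x != 0 ->
  kbracket i x * E j ^+ r = E j ^+ r * kbracket i (x * (qi i ^ a i j) ^+ r).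
Proof.
move=> x0; elim: r => [|r IH]; first by rewrite !mulr1 mul1r.
rewrite exprSr mulrA IH -!mulrA hE.
  by rewrite -mulrA -exprSr.
by rewrite mulf_neq0 // expf_neq0 // expfz_neq0 // qi_neq0.
Qed.

(** Each of the [s.+1] factors contributes multiples of [E i ^+ s * K i] and of
    [E i ^+ s * K' i], and the coefficients add up to a quantum integer. *)
Lemma EX_comm i s :
  E i ^+ s.+1 * F i - F i * E i ^+ s.+1
    = qint (qi i) s.+1 *: (E i ^+ s * kbracket i (qi i ^+ s)).
Proof.
have qi0 := qi_neq0 i; have nr := @qi_not_root i.
have dn := qdenom_neq0 qi0 nr.
have hh : E i * F i - F i * E i = kbracket i 1.
  by rewrite (ns_EF rel) eqxx /kbracket invr1 !scale1r.
elim: s => [|s IH].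
  by rewrite expr1 hh mul1r /qint expr0 !expr1 divff // scale1r.
have -> : E i ^+ s.+2 * F i - F i * E i ^+ s.+2 =
    E i * (E i ^+ s.+1 * F i - F i * E i ^+ s.+1)
      + (E i * F i - F i * E i) * E i ^+ s.+1.
  by rewrite (exprS _ s.+1) mulrBr mulrBl !mulrA addrA subrK.
rewrite IH hh hEX ?oner_neq0 // -scalerAr mulrA -exprS.
rewrite mul1r a_diag !scalerAr -mulrDr; congr (_ * _).
rewrite /kbracket ![_ *: (_^-1 *: _)]scalerA ![qint _ _ * _]mulrC -!scalerA -scalerDr.
congr (_ *: _); rewrite !scalerBr !scalerA addrACA -opprD -!scalerDl.
have kk1 : qi i * qi i - 1 != 0 by rewrite subr_eq0 -expr2 nr.
have e2 : (qi i ^ 2) ^+ s.+1 = qi i ^+ s.+1 * qi i ^+ s.+1.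
  by rewrite -exprnP -exprM mulnC exprM expr2.
rewrite e2; congr (_ *: _ - _ *: _); rewrite /qint !exprS.
  by field; rewrite qi0 kk1 !expf_neq0.
by field; rewrite qi0 kk1 !expf_neq0.
Qed.

(** The Serre element is of degree [m.+1] in [E i], where [a i j = - m]. *)
Lemma serre_deg i j : i != j ->
  exists m : nat, a i j = - m%:Z /\ `|1 - a i j|%N = m.+1.
Proof. by move=> /a_offdiag; exists `|a i j|%N; split; lia. Qed.

Lemma serre_commE i j k : serre_elt E i j * F k - F k * serre_elt E i j =
  \sum_(r < `|1 - a i j|.+1) ((-1) ^+ r * qbinom (qi i) `|1 - a i j| r)
     *: (E i ^+ (`|1 - a i j| - r) * E j * E i ^+ r * F k
          - F k * (E i ^+ (`|1 - a i j| - r) * E j * E i ^+ r)).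
Proof.
rewrite mulr_suml mulr_sumr -sumrB; apply: eq_bigr => r _.
by rewrite -scalerAl -scalerAr -scalerBr.
Qed.

Lemma EX_comm_neq i k r : i != k -> E i ^+ r * F k = F k * E i ^+ r.
Proof.
move=> ik; apply/esym/commrX; rewrite /GRing.comm; apply/esym/eqP.
by rewrite -subr_eq0 (ns_EF rel) (negPf ik).
Qed.

(** With [m = 1 - a i j], both ends of [E i ^+ (m - r) * E j * E i ^+ r] produce
    a multiple of [E i ^+ (m - r - 1) * E j * E i ^+ r] by the commutator with
    [F i], and the terms for [r] and [r + 1] cancel. *)
Lemma serre_comm_first i j : i != j -> serre_elt E i j * F i = F i * serre_elt E i j.
Proof.
move=> ij; apply/eqP; rewrite -subr_eq0 serre_commE.
have [m [am ->]] := serre_deg ij.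
have qi0 := qi_neq0 i; have nr := @qi_not_root i.
have jF : E j * F i = F i * E j.
  by have := EX_comm_neq 1 (_ : j != i); rewrite !expr1 => -> //; rewrite eq_sym.
have split_comm t r : E i ^+ t * E j * E i ^+ r * F i
      - F i * (E i ^+ t * E j * E i ^+ r) =
    (E i ^+ t * F i - F i * E i ^+ t) * (E j * E i ^+ r)
    + E i ^+ t * E j * (E i ^+ r * F i - F i * E i ^+ r).
  rewrite mulrBl mulrBr !mulrA -[E i ^+ t * E j * F i]mulrA jF mulrA.
  by rewrite [RHS]addrC addrA subrK.
under eq_bigr => r _ do rewrite split_comm scalerDr.
rewrite big_split big_ord_recr [X in _ + X == _]big_ord_recl /=.
rewrite subnn !expr0 !(mul1r (F i)) !(mulr1 (F i)) !subrr mul0r mulr0 !scaler0.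
rewrite addr0 add0r -big_split /= big1 // => r _.
have rm : (r <= m)%N by rewrite -ltnS.
rewrite /bump /= add1n subSS subSn // !EX_comm.
have -> : (qint (qi i) (m - r).+1 *: (E i ^+ (m - r) * kbracket i (qi i ^+ (m - r))))
     * (E j * E i ^+ r) =
   qint (qi i) (m - r).+1 *: (E i ^+ (m - r) * E j * (E i ^+ r * kbracket i (qi i ^+ r))).
  rewrite -scalerAl; congr (_ *: _).
  rewrite -!mulrA; congr (_ * _); rewrite [LHS]mulrA hE ?expf_neq0 // -mulrA.
  rewrite hEX ?mulf_neq0 ?expf_neq0 ?expfz_neq0 //; congr (_ * (_ * kbracket i _)).
  rewrite am a_diag -exprnP -exprnN; move: (qi i) qi0 => k k0.
  by rewrite expfB_cond ?(negPf k0) // -exprM mulnC exprM; field; rewrite !expf_neq0.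
move: (E i ^+ r * kbracket i _) => Z.
rewrite -scalerAr !scalerA -scalerDl -!(mulrA ((-1) ^+ _)) qbinom_shift //.
by rewrite exprS mulN1r mulNr subrr scale0r.
Qed.

(** Here [E i] and [F j] commute, and commuting the [K j] that come from
    [E j] and [F j] past powers of [E i] leaves the two alternating
    sums of quantum binomials that vanish. *)
Lemma serre_comm_second i j : i != j ->
  serre_elt E i j * F j = F j * serre_elt E i j.
Proof.
move=> ij; apply/eqP; rewrite -subr_eq0 serre_commE.
have [m [am ->]] := serre_deg ij.
have qi0 := qi_neq0 i; have nr := @qi_not_root i.
under eq_bigr => r _.
  have -> : E i ^+ (m.+1 - r) * E j * E i ^+ r * F j
      - F j * (E i ^+ (m.+1 - r) * E j * E i ^+ r) =
    E i ^+ m.+1 * kbracket j (((qi i) ^- m) ^+ r).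
    rewrite -mulrA (EX_comm_neq _ ij) !mulrA -(EX_comm_neq _ ij).
    rewrite -mulrBl -!(mulrA _ _ (F j)) -!(mulrA _ (F j) (E j)) -mulrBr (ns_EF rel) eqxx.
    have -> : (qi j - (qi j)^-1)^-1 *: (K j - K' j) = kbracket j 1.
      by rewrite /kbracket invr1 !scale1r.
    rewrite -mulrA hEX ?oner_neq0 // mulrA -exprD subnK ?mul1r -1?ltnS //.
    by rewrite -qiz_sym am -exprnN.
  over.
under eq_bigr => r _ do rewrite scalerAr.
rewrite -mulr_sumr /kbracket.
under eq_bigr => r _ do
  rewrite scalerA mulrC -scalerA scalerBr !scalerA -exprVn invrK.
rewrite -scaler_sumr sumrB -!scaler_suml qbinom_altsum // qbinom_altsumV //.
by rewrite !scale0r subr0 scaler0 mulr0.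
Qed.

(** In the remaining case [F k] commutes with both [E i] and [E j]. *)
Lemma serre_comm i j k : i != j -> serre_elt E i j * F k = F k * serre_elt E i j.
Proof.
move=> ij; have [-> | ki] := eqVneq k i; first exact: serre_comm_first.
have [-> | kj] := eqVneq k j; first exact: serre_comm_second.
apply/eqP; rewrite -subr_eq0 serre_commE big1 // => r _.
rewrite -mulrA EX_comm_neq 1?eq_sym // !mulrA.
rewrite -(mulrA _ (E j)) -(expr1 (E j)) EX_comm_neq 1?eq_sym // !mulrA.
by rewrite EX_comm_neq 1?eq_sym // subrr scaler0.
Qed.

End Algebra.

(** An element that commutes up to scalars with all generators also does so
    with the Serre elements, since these are homogeneous. *)
Lemma serre_eigen (A : algType C) (X : 'I_n -> A) (x : A) (c : 'I_n -> C) i j :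
  (forall k, x * X k = c k *: (X k * x)) ->
  x * serre_elt X i j =
    (c i ^+ `|1 - a i j| * c j) *: (serre_elt X i j * x).
Proof.
move=> xX; have xXn k r : x * X k ^+ r = c k ^+ r *: (X k ^+ r * x).
  elim: r => [|r IH]; first by rewrite mulr1 mul1r scale1r.
  rewrite exprSr mulrA IH -scalerAl -(mulrA _ x (X k)) xX -scalerAr scalerA mulrA.
  by rewrite -!exprSr.
rewrite mulr_sumr mulr_suml scaler_sumr; apply: eq_bigr => r _.
rewrite -scalerAr -scalerAl; move: (_ * qbinom _ _ _) => k.
rewrite [RHS]scalerA [_ * k]mulrC -[RHS]scalerA; congr (_ *: _).
rewrite !mulrA xXn -!scalerAl -(mulrA _ x) xX -scalerAr -!scalerAl.
rewrite !mulrA -(mulrA _ x) xXn -scalerAr !scalerA !mulrA; congr (_ *: _).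
have rm : (r <= `|1 - a i j|)%N by rewrite -ltnS.
by rewrite mulrAC -exprD subnK.
Qed.

End NonSerre.
(** * Linear spans and generated subalgebras *)

Section Spans.
Variables (C : fieldType) (U : algType C).
Implicit Types (A B V : set U).

(** These predicates state the closure conditions for [V] itself rather than for
    the boolean predicate [mem V]. *)
Definition subspace V := V 0 /\ forall c x y, V x -> V y -> V (c *: x + y).

Definition submonoid V := V 1 /\ forall x y, V x -> V y -> V (x * y).

Lemma submod_closedP V : GRing.submod_closed (mem V) <-> subspace V.
Proof.
split=> -[V0 VL]; split; first by rewrite -in_setE.
- by move=> c x y Vx Vy; rewrite -in_setE; apply: VL; rewrite in_setE.
- by rewrite in_setE.
- by move=> c x y; rewrite !in_setE; apply: VL.
Qed.

Lemma subalg_closedP V :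
  GRing.subalg_closed (mem V) <-> subspace V /\ submonoid V.
Proof.
split=> [VA|[[V0 VL] [V1 VM]]].
  have [V1 VL VM] := VA; have /submod_closedP VS := GRing.subalg_closedZ VA.
  split=> //; split; first by rewrite -in_setE.
  by move=> x y Vx Vy; rewrite -in_setE; apply: VM; rewrite in_setE.
split; first by rewrite in_setE.
- by move=> c x y; rewrite !in_setE; apply: VL.
- by move=> x y; rewrite !in_setE; apply: VM.
Qed.

Lemma subspaceD V x y : subspace V -> V x -> V y -> V (x + y).
Proof. by case=> _ VL Vx Vy; rewrite -[x]scale1r; apply: VL. Qed.

Lemma subspaceZ V c x : subspace V -> V x -> V (c *: x).
Proof. by case=> V0 VL Vx; rewrite -[_ *: _]addr0; apply: VL. Qed.

Lemma subspaceN V x : subspace V -> V x -> V (- x).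
Proof. by move=> VS Vx; rewrite -scaleN1r; apply: subspaceZ. Qed.

Lemma subspaceB V x y : subspace V -> V x -> V y -> V (x - y).
Proof. by move=> VS Vx Vy; apply: subspaceD => //; apply: subspaceN. Qed.

Lemma lspan_subspace A : subspace (lspan A).
Proof.
split; first by move=> V [/submod_closedP[]].
move=> c x y Ax Ay V VA; have [/submod_closedP[_ VL] _] := VA.
by apply: VL; [apply: Ax|apply: Ay].
Qed.

Lemma lspan0 A : lspan A 0. Proof. by case: (lspan_subspace A). Qed.

Lemma sub_lspan A : A `<=` lspan A. Proof. exact: sub_gen_smallest. Qed.

Lemma lspan_sub A V : subspace V -> A `<=` V -> lspan A `<=` V.
Proof. by move=> /submod_closedP; apply: smallest_sub. Qed.

Lemma subalg_gen_subspace A : subspace (subalg_gen A).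
Proof.
split; first by move=> V [/subalg_closedP[[]]].
move=> c x y Ax Ay V VA; have [/subalg_closedP[[_ VL] _] _] := VA.
by apply: VL; [apply: Ax|apply: Ay].
Qed.

Lemma subalg_gen_submonoid A : submonoid (subalg_gen A).
Proof.
split; first by move=> V [/subalg_closedP[_ []]].
move=> x y Ax Ay V VA; have [/subalg_closedP[_ [_ VM]] _] := VA.
by apply: VM; [apply: Ax|apply: Ay].
Qed.

Lemma sub_subalg_gen A : A `<=` subalg_gen A. Proof. exact: sub_gen_smallest. Qed.

Lemma subalg_gen_sub A V :
  subspace V -> submonoid V -> A `<=` V -> subalg_gen A `<=` V.
Proof. by move=> VS VM; apply: smallest_sub; apply/subalg_closedP. Qed.

Lemma lspan_linear A V (f : U -> U) x :
  linear f -> subspace V -> (forall y, A y -> V (f y)) -> lspan A x -> V (f x).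
Proof.
move=> lf [V0 VL] AV; apply: (@lspan_sub A (fun y => V (f y))) => //.
split=> [|c y z Vy Vz]; last by rewrite lf; apply: VL.
by have := scalable_linear lf 0 0; rewrite /= !scale0r => ->.
Qed.

Lemma linear_mull (x : U) : linear (fun y => x * y).
Proof. by move=> c y z; rewrite mulrDr scalerAr. Qed.

Lemma linear_mulr (x : U) : linear (fun y => y * x).
Proof. by move=> c y z; rewrite mulrDl scalerAl. Qed.

Lemma lspan_mul A B V : subspace V ->
  (forall x y, A x -> B y -> V (x * y)) ->
  forall x y, lspan A x -> lspan B y -> V (x * y).
Proof.
move=> VS AB x y Ax By; apply: (lspan_linear (linear_mull x) VS _ By) => y' By'.
apply: (lspan_linear (linear_mulr y') VS _ Ax) => x' Ax'.
exact: AB.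
Qed.

End Spans.
(** * A coinduced representation *)

Section Coinduced.
Variables (C : fieldType) (n : nat) (a : 'M[int]_n) (d : 'I_n -> nat) (q : C).
Hypotheses (q_neq0 : q != 0)
  (q_not_root : forall m : nat, (0 < m)%N -> q ^+ m != 1).
Hypotheses (a_diag : forall i, a i i = 2)
  (a_offdiag : forall i j, i != j -> a i j <= 0)
  (d_gt0 : forall i, (0 < d i)%N)
  (a_sym : forall i j, (d i)%:Z * a i j = (d j)%:Z * a j i).
Variables (U : algType C) (E F K K' : 'I_n -> U).

Local Notation qi i := (q ^+ d i).
Local Notation W := (seq 'I_n -> U).
Local Notation c_ i := ((qi i - (qi i)^-1)^-1).

(** A function [f] on words stands for a [U]-linear map on a free left module with
    basis the words, read from right to left: [i :: s] is the word [s] followed by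
    [F i] on its right. The operators are precomposition with right
    multiplication by the generators, where [kw i s] comes from moving [K i] to the
    left of the word and the recursion for [E i] from
    [F j * E i = E i * F j - [E i, F j]]. *)
Definition kw i (s : seq 'I_n) : C := \prod_(j <- s) qi i ^ a i j.

Definition opF i (f : W) : W := fun s => f (i :: s).
Definition opK i (f : W) : W := fun s => kw i s *: (K i * f s).
Definition opK' i (f : W) : W := fun s => (kw i s)^-1 *: (K' i * f s).
Fixpoint opE i (f : W) (s : seq 'I_n) : U :=
  match s with
  | [::] => E i * f [::]
  | j :: s' => opE i (opF j f) s'
      - (if i == j then c_ i *: (opK i f s' - opK' i f s') else 0)
  end.

Lemma kw_cons i j s : kw i (j :: s) = qi i ^ a i j * kw i s.
Proof. by rewrite /kw big_cons. Qed.

Lemma kw_cat i s t : kw i (s ++ t) = kw i s * kw i t.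
Proof. by rewrite /kw big_cat. Qed.

Lemma kw_neq0 i s : kw i s != 0.
Proof.
elim: s => [|j s IH]; first by rewrite /kw big_nil oner_neq0.
by rewrite kw_cons mulf_neq0 // expfz_neq0 // qi_neq0.
Qed.

Lemma WE (c : C) (f g : W) s : (c *: f + g) s = c *: f s + g s.
Proof. by []. Qed.

Lemma opF_linear i : linear (opF i).
Proof. by move=> c f g; apply/funext. Qed.

Lemma opK_linear i : linear (opK i).
Proof.
move=> c f g; apply/funext => s; rewrite WE /opK WE mulrDr scalerDr.
by rewrite -scalerAr !scalerA mulrC.
Qed.

Lemma opK'_linear i : linear (opK' i).
Proof.
move=> c f g; apply/funext => s; rewrite WE /opK' WE mulrDr scalerDr.
by rewrite -scalerAr !scalerA mulrC.
Qed.

Lemma opE_linear i : linear (opE i).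
Proof.
move=> c f g; apply/funext => s; rewrite WE.
elim: s f g => [|j s IH] f g /=; first by rewrite WE mulrDr -scalerAr.
rewrite opF_linear IH; case: eqP => [->|_]; last by rewrite !subr0.
rewrite opK_linear opK'_linear !WE.
move: (opK _ f s) (opK _ g s) (opK' _ f s) (opK' _ g s) => x y x' y'.
have -> : c *: x + y - (c *: x' + y') = c *: (x - x') + (y - y').
  by rewrite scalerBr opprD addrACA.
by rewrite scalerDr opprD addrACA scalerA mulrC -scalerA -scalerBr.
Qed.

Lemma cst1_neq0 : (fun=> 1 : U) != 0 :> W.
Proof.
by apply/eqP => /(congr1 (fun f : W => f [::])) /eqP; rewrite oner_eq0.
Qed.

Local Notation LW := (lend cst1_neq0).
Definition FW i : LW := mkl _ (opF_linear i).
Definition KW i : LW := mkl _ (opK_linear i).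
Definition KW' i : LW := mkl _ (opK'_linear i).
Definition EW i : LW := mkl _ (opE_linear i).

Hypothesis rel : nonserre_relations a d q E F K K'.

Lemma opFK i j f : opF j (opK i f) = (qi i ^ a i j) *: opK i (opF j f).
Proof.
by apply/funext => s; rewrite /opF /opK kw_cons -scalerA.
Qed.

Lemma opKK i j f : opK i (opK j f) = opK j (opK i f).
Proof.
apply/funext => s; rewrite /opK -!scalerAr !mulrA (ns_KK rel).
by rewrite !scalerA mulrC.
Qed.

Lemma opKK' i j f : opK i (opK' j f) = opK' j (opK i f).
Proof.
apply/funext => s; rewrite /opK /opK' -!scalerAr !mulrA (ns_KK' rel).
by rewrite !scalerA mulrC.
Qed.

Lemma opKE i j f : opK i (opE j f) = (qi i ^ a i j) *: opE j (opK i f).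
Proof.
apply/funext => s; rewrite -[RHS]/(qi i ^ a i j *: opE j (opK i f) s).
elim: s f => [|l s IH] f.
  rewrite /= /opK /kw big_nil !scale1r !mulrA.
  by rewrite (ns_KE_comm rel) // -scalerAl.
have -> : opK i (opE j f) (l :: s) = qi i ^ a i l *: opK i (opE j (opF l f)) s
    - kw i (l :: s) *: (K i * (if j == l then c_ j *: (opK j f s - opK' j f s) else 0)).
  by rewrite /opK /= mulrBr scalerBr kw_cons scalerA.
have opEZ c g t : opE j (c *: g) t = c *: opE j g t.
  by rewrite (scalable_linear (opE_linear j)).
rewrite IH /= opFK opEZ [RHS]scalerBr. congr (_ - _).
  by rewrite [LHS]scalerA [RHS]scalerA mulrC.
case: eqP => [<-|_]; last by rewrite mulr0 !scaler0.
rewrite -opKK -opKK' {2 4}/opK.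
rewrite -scalerBr -mulrBr -scalerAr kw_cons !scalerA; congr (_ *: _).
by rewrite -!mulrA [kw i s * _]mulrC.
Qed.

Lemma nonserre_W : nonserre_relations a d q EW FW KW KW'.
Proof.
have KV i (f : W) : opK i (opK' i f) = f /\ opK' i (opK i f) = f.
  have [K1 K2] := ns_KV rel i.
  split; apply/funext => s; rewrite /opK /opK' -scalerAr scalerA mulrA.
    by rewrite K1 mul1r divff ?scale1r // kw_neq0.
  by rewrite K2 mul1r mulVf ?scale1r // kw_neq0.
split.
- by move=> i; split; apply: lendP => f; rewrite /= /comp; have [] := KV i f.
- by move=> i j; apply: lendP => f; apply: opKK.
- move=> i j; apply: lendP => f.
  rewrite -[LHS]/(opK i (opE j (opK' i f))) opKE.
  by have [-> _] := KV i f.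
- move=> i j; apply: lendP => f.
  rewrite -[LHS]/(opK i (opF j (opK' i f))).
  rewrite -[RHS]/((qi i ^ (- a i j)) *: opF j f).
  have -> : opF j f = opF j (opK i (opK' i f)) by have [-> _] := KV i f.
  rewrite opFK scalerA -expfzDr ?qi_neq0 //.
  by rewrite addNr expr0z scale1r.
- move=> i j; apply: lendP => f; apply/funext => s.
  rewrite -[LHS]/(opE i (opF j f) s - opE i f (j :: s)) /= opprB addrC subrK.
  by case: eqP => [->|].
Qed.

Local Notation serreFW i j := (serre_elt a d q FW i j).

(** These functions are the linear maps from the free algebra on the [F i] to [U] that
    vanish on the two-sided ideal of the Serre elements: [w] is the right-hand
    factor, and the argument of the resulting function the left-hand one. *)
Definition serre_null : {pred W} := fun f =>
  `[< forall i j, i != j -> forall w, serreFW i j (fun t => f (w ++ t)) = 0 >].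

Lemma serre_nullP f : reflect
  (forall i j, i != j -> forall w, serreFW i j (fun t => f (w ++ t)) = 0)
  (f \in serre_null).
Proof. exact: asboolP. Qed.

Lemma serre_null_submod : submod_closed serre_null.
Proof.
split.
  by apply/serre_nullP => i j _ w; apply: lend0.
move=> c f g /serre_nullP f0 /serre_nullP g0; apply/serre_nullP => i j ij w.
have := lend_linear (serreFW i j) c (fun t => f (w ++ t)) (fun t => g (w ++ t)).
by rewrite f0 // g0 // scaler0 addr0.
Qed.

HB.instance Definition _ := GRing.isSubmodClosed.Build C W serre_null
  serre_null_submod.

Record coind := Coind { coind_fun :> W; coindP : coind_fun \in serre_null }.

HB.instance Definition _ := [isSub for coind_fun].
HB.instance Definition _ := [Choice of coind by <:].
HB.instance Definition _ := [SubChoice_isSubLmodule of coind by <:].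

Lemma opF_null k f : f \in serre_null -> opF k f \in serre_null.
Proof.
by move=> /serre_nullP f0; apply/serre_nullP => i j ij w; apply: (f0 i j ij (k :: w)).
Qed.

(** An operator that commutes with a Serre element up to a nonzero scalar
    preserves its kernel. *)
Lemma scaled_null (f g : W) (X : LW) (c c' : C) i j :
    c != 0 -> X * serreFW i j = c *: (serreFW i j * X) ->
    f = c' *: X g -> serreFW i j g = 0 -> serreFW i j f = 0.
Proof.
move=> c0 XS -> Sg; rewrite lend_scale -lendM.
have -> : serreFW i j * X = c^-1 *: (X * serreFW i j).
  by rewrite XS scalerA mulVf // scale1r.
by rewrite lendZ lendM Sg lend0 !scaler0.
Qed.

Lemma opK_null k f : f \in serre_null -> opK k f \in serre_null.
Proof.
move=> /serre_nullP f0; apply/serre_nullP => i j ij w.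
have KF l : KW k * FW l = (qi k ^ - a k l) *: (FW l * KW k).
  exact: (ns_K'E_comm q_neq0 (nonserre_swap q_neq0 nonserre_W)).
apply: scaled_null (serre_eigen a d q i j KF) _ (f0 i j ij w).
  by rewrite mulf_neq0 ?expf_neq0 ?expfz_neq0 ?qi_neq0.
apply/funext => s; rewrite /opK kw_cat -scalerA.
by instantiate (1 := kw k w).
Qed.

Lemma opK'_null k f : f \in serre_null -> opK' k f \in serre_null.
Proof.
move=> /serre_nullP f0; apply/serre_nullP => i j ij w.
have KF l : KW' k * FW l = (qi k ^ a k l) *: (FW l * KW' k).
  exact: (ns_KE_comm (nonserre_swap q_neq0 nonserre_W)).
apply: scaled_null (serre_eigen a d q i j KF) _ (f0 i j ij w).
  by rewrite mulf_neq0 ?expf_neq0 ?expfz_neq0 ?qi_neq0.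
apply/funext => s; rewrite /opK' kw_cat invfM -scalerA.
by instantiate (1 := (kw k w)^-1).
Qed.

(** Translation by [w] can be moved past [opE k] letter by letter, each step
    producing [opK k] and [opK' k], which preserve the subspace. Once no letter
    is left, [opE k] commutes with the Serre elements. *)
Lemma opE_null k f : f \in serre_null -> opE k f \in serre_null.
Proof.
move=> fN; apply/serre_nullP => i j ij w.
elim: w f fN => [|l w IH] f fN.
  have ES := serre_comm q_neq0 q_not_root a_diag a_offdiag d_gt0 a_sym
               (nonserre_swap q_neq0 nonserre_W) k ij.
  have := congr1 (fun X : LW => X f) ES; rewrite !lendM => ->.
  by have /serre_nullP/(_ i j ij [::]) -> := fN; apply: lend0.
pose z := if k == l then c_ k else 0.
have -> : (fun t => opE k f ((l :: w) ++ t)) = (fun t => opE k (opF l f) (w ++ t))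
   + (- z) *: ((fun t => opK k f (w ++ t)) + -1 *: (fun t => opK' k f (w ++ t))).
  apply/funext => t; rewrite /= scaleN1r /z scaleNr.
  by case: eqP => // _; rewrite scale0r.
have := lend_linear (serreFW i j); rewrite addrC => lin; rewrite lin.
rewrite IH ?opF_null // addr0 addrC lin.
have /serre_nullP -> // := opK_null k fN; have /serre_nullP -> // := opK'_null k fN.
by rewrite scaler0 addr0 scaler0.
Qed.

Definition content (s : seq 'I_n) : 'rV[int]_n := \sum_(i <- s) simple_root i.

Lemma content_cat s t : content (s ++ t) = content s + content t.
Proof. by rewrite /content big_cat. Qed.

(** The reversal agrees with the convention for the functions on words, whose
    first letter is the rightmost factor. *)
Definition monF (s : seq 'I_n) : U := \prod_(i <- rev s) F i.

Lemma monF_cat s t : monF (s ++ t) = monF t * monF s.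
Proof. by rewrite /monF rev_cat big_cat. Qed.

Lemma monF_nseq r i : monF (nseq r i) = F i ^+ r.
Proof.
rewrite /monF rev_nseq big_nseq; elim: r => //= r ->.
by rewrite exprS.
Qed.

(** The canonical map from words to [U], cut down to the words of degree [g]: the
    matrix coefficients of these vectors are the projections. *)
Definition vac (g : 'rV[int]_n) : W :=
  fun s => if content s == g then monF s else 0.

Lemma FWX i r (f : W) s : (FW i ^+ r) f s = f (nseq r i ++ s).
Proof.
by rewrite lendX; elim: r f => [|r IH] f //; rewrite iterSr IH.
Qed.

Hypothesis serreF : forall i j, i != j -> serre_rel a d q F i j.

(** All words in a Serre element have the same degree, so the restriction to
    degree [g] is harmless, and the Serre relation of [U] applies to the values. *)
Lemma vac_null g : vac g \in serre_null.
Proof.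
apply/serre_nullP => i j ij w; apply/funext => s.
rewrite lend_sum fct_sumE.
pose m := `|1 - a i j|%N; rewrite -/m.
have mono (r : 'I_m.+1) : (FW i ^+ (m - r) * FW j * FW i ^+ r)
      (fun t => vac g (w ++ t)) s =
    if content w + simple_root i *+ m + simple_root j + content s == g
    then monF s * (F i ^+ (m - r) * F j * F i ^+ r) * monF w else 0.
  rewrite !lendM FWX -[LHS]/((FW i ^+ r) _ (j :: _)) FWX /vac.
  rewrite -cat1s !content_cat !monF_cat !monF_nseq.
  have cn t : content (nseq t i) = simple_root i *+ t.
    by rewrite /content big_nseq; elim: t => //= t ->; rewrite mulrS.
  rewrite !cn {2}/content big_seq1.
  have -> : content w + (simple_root i *+ r + (simple_root j +
       (simple_root i *+ (m - r) + content s))) =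
     content w + simple_root i *+ m + simple_root j + content s.
    have rm : (r <= m)%N by rewrite -ltnS.
    rewrite -[in RHS](subnKC rm) mulrnDr -!addrA; congr (_ + (_ + _)).
    by rewrite addrCA.
  have -> : monF [:: j] = F j by rewrite /monF /rev /= big_seq1.
  by rewrite !mulrA.
under eq_bigr => r _.
  have -> (c : C) (X : LW) f t : (c *: X) f t = c *: X f t by [].
  rewrite mono; over.
case: (content w + _ + _ + _ == g); last by rewrite big1 // => r _; rewrite scaler0.
under eq_bigr => r _ do rewrite scalerAl scalerAr.
rewrite -mulr_suml -mulr_sumr.
have := serreF ij; rewrite /serre_rel -/m => ->.
by rewrite mulr0 mul0r.
Qed.

Definition vacV g : coind := Coind (vac_null g).

Lemma vac_nil g : vac g [::] = (0 == g)%:R.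
Proof. by rewrite /vac /content big_nil /monF /rev /= big_nil; case: eqP. Qed.

Lemma vacV_neq0 : vacV 0 != 0.
Proof.
apply/eqP => /(congr1 (fun f : coind => f [::])) /eqP.
by rewrite /= vac_nil eqxx oner_eq0.
Qed.

Local Notation LV := (lend vacV_neq0).

Section Restriction.
Variables (X : LW) (X_null : forall f, f \in serre_null -> X f \in serre_null).
Lemma restr_linear : linear (fun f : coind => Coind (X_null (coindP f))).
Proof. by move=> c f g; apply/val_inj; rewrite /= lend_linear. Qed.
Definition restr : LV := mkl _ restr_linear.
End Restriction.

Definition FV i := restr (@opF_null i : forall f, _ -> FW i f \in _).
Definition KV i := restr (@opK_null i : forall f, _ -> KW i f \in _).
Definition KV' i := restr (@opK'_null i : forall f, _ -> KW' i f \in _).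
Definition EV i := restr (@opE_null i : forall f, _ -> EW i f \in _).

Lemma nonserre_V : nonserre_relations a d q EV FV KV KV'.
Proof.
have [rKV rKK rKE rKF rEF] := nonserre_W.
split.
- by move=> i; have [r1 r2] := rKV i; split; apply: lendP => f; apply/val_inj;
    [have := congr1 (fun X : LW => X (val f)) r1
    |have := congr1 (fun X : LW => X (val f)) r2].
- move=> i j; apply: lendP => f; apply/val_inj.
  by have := congr1 (fun X : LW => X (val f)) (rKK i j).
- move=> i j; apply: lendP => f; apply/val_inj.
  by have := congr1 (fun X : LW => X (val f)) (rKE i j).
- move=> i j; apply: lendP => f; apply/val_inj.
  by have := congr1 (fun X : LW => X (val f)) (rKF i j).
- move=> i j; apply: lendP => f; apply/val_inj.
  by have := congr1 (fun X : LW => X (val f)) (rEF i j); case: eqP.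
Qed.

Lemma val_sum (I : finType) (f : I -> coind) :
  val (\sum_i f i) = \sum_i val (f i).
Proof. exact: (raddf_sum (val : coind -> W)). Qed.

Lemma valZ (c : C) (f : coind) : val (c *: f) = c *: val f. Proof. by []. Qed.

Lemma restrX (X : 'I_n -> LW) (Y : 'I_n -> LV) i r f :
  (forall g, val (Y i g) = X i (val g)) -> val ((Y i ^+ r) f) = (X i ^+ r) (val f).
Proof. by move=> YX; rewrite !lendX; elim: r => //= r <-. Qed.

Lemma serreFV i j : i != j -> serre_rel a d q FV i j.
Proof.
move=> ij; apply: lendP => f; apply/val_inj.
transitivity (serreFW i j (val f)).
  2: by have /serre_nullP/(_ i j ij [::]) := coindP f.
rewrite !lend_sum val_sum; apply: eq_bigr => r _.
rewrite !lendZ valZ !lendM.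
rewrite (@restrX FW) // -[val (FV j _)]/(FW j (val _)) (@restrX FW) //.
Qed.

(** An operator commuting with the [FV l] is determined by its values on the
    empty word; those of the Serre element are obtained by acting with the Serre
    element of [U]. *)
Lemma serreEV i j : (forall i j, i != j -> serre_rel a d q E i j) ->
  i != j -> serre_rel a d q EV i j.
Proof.
move=> serreE ij; pose S := serre_elt a d q EV i j.
suff S0 s f : val (S f) s = 0 by apply: lendP => f; apply/val_inj/funext => s; apply: S0.
elim: s f => [|l s IH] f; last first.
  have FS := serre_comm q_neq0 q_not_root a_diag a_offdiag d_gt0 a_sym nonserre_V l ij.
  have : val ((S * FV l) f) s = val ((FV l * S) f) s by rewrite FS.
  by rewrite !lendM IH => /esym.
have EV1 k g : val (EV k g) [::] = E k * val g [::] by [].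
have EX k r g : val ((EV k ^+ r) g) [::] = E k ^+ r * val g [::].
  elim: r => [|r IH]; first by rewrite mul1r.
  by rewrite exprS lendM exprS -mulrA -IH -EV1.
rewrite lend_sum val_sum fct_sumE.
transitivity (serre_elt a d q E i j * val f [::]).
  rewrite mulr_suml; apply: eq_bigr => r _.
  by rewrite -scalerAl -!mulrA -EX -EV1 -EX.
by have -> : serre_elt a d q E i j = 0; [apply: serreE|rewrite mul0r].
Qed.

Definition monE (s : seq 'I_n) : U := \prod_(i <- s) E i.

Lemma serreE_of_Uq : is_Uq a d q E F K K' ->
  forall i j, i != j -> serre_rel a d q E i j.
Proof. by case=> [[]]. Qed.

(** Acting on [vacV g] and evaluating at the empty word sends a triangular
    monomial to itself or to zero according to the degree of its last factor. *)
Lemma triangular_projection : is_Uq a d q E F K K' ->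
  forall g, exists p : U -> U, linear p /\
    forall v u w, Ucartan K K' u ->
      p (monE v * u * monF w) =
        if content w == g then monE v * u * monF w else 0.
Proof.
move=> hU g.
have relV : Uq_relations a d q EV FV KV KV'.
  have [rKV rKK rKE rKF rEF] := nonserre_V; split=> //; last exact: serreFV.
  by move=> i j; apply: serreEV; apply: serreE_of_Uq.
have [phi phiE] := Uq_lift hU relV.
pose good := [set x : U | forall f, val (phi x f) [::] = x * val f [::]].
(* For elements of the subalgebra generated by the E i and U^0, evaluation at the
   empty word intertwines the action with left multiplication. *)
have good_sub : subspace good.
  split=> [f|c x y gx gy f]; first by rewrite rmorph0 mul0r.
  by rewrite linearP -[LHS]/(c *: val (phi x f) [::] + val (phi y f) [::]) gx gy mulrDl scalerAl.
have good_mon : submonoid good.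
  split=> [f|x y gx gy f]; first by rewrite rmorph1 mul1r.
  by rewrite rmorphM -[LHS]/(val (phi x (phi y f)) [::]) gx gy mulrA.
have goodK : Ucartan K K' `<=` good.
  apply: subalg_gen_sub => // x [[i _ <-]|[i _ <-]] f; have [_ _ e1 e2] := phiE i.
    by rewrite e1 /= /opK /kw big_nil scale1r.
  by rewrite e2 /= /opK' /kw big_nil invr1 scale1r.
have goodE v : good (monE v).
  elim: v => [|i v IH]; rewrite /monE ?big_nil; first by case: good_mon.
  rewrite big_cons; case: good_mon => _; apply => // f.
  by have [-> _ _ _] := phiE i.
(* Monomials in the F i, on the other hand, translate the argument. *)
have monFE w f : val (phi (monF w) f) [::] = val f w.
  elim: w f => [|i w IH] f; first by rewrite /monF /rev /= big_nil rmorph1.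
  rewrite -cat1s monF_cat rmorphM -[LHS]/(val (phi _ (phi _ f)) [::]) IH.
  have -> : monF [:: i] = F i by rewrite /monF /rev /= big_seq1.
  by have [_ -> _ _] := phiE i.
exists (fun x => val (phi x (vacV g)) [::]); split=> [c x y|v u w uK].
  by rewrite linearP.
rewrite !rmorphM -[LHS]/(val (phi _ (phi _ (phi _ _))) [::]).
rewrite goodE goodK // monFE /= /vac mulrA.
by case: eqP; rewrite ?mulr0.
Qed.

End Coinduced.
(** * Generation and weight spaces *)

Section Generation.
Variables (C : fieldType) (n : nat) (a : 'M[int]_n) (d : 'I_n -> nat) (q : C).
Variables (U : algType C) (E F K K' : 'I_n -> U).

Definition Uq_gens : set U :=
  range E `|` (range F `|` (range K `|` range K')).

Definition in_gen : {pred U} := mem (subalg_gen Uq_gens).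

Lemma in_gen_closed : GRing.subalg_closed in_gen.
Proof.
apply/subalg_closedP; split; [exact: subalg_gen_subspace|].
exact: subalg_gen_submonoid.
Qed.

HB.instance Definition _ := GRing.isSubalgClosed.Build C U in_gen in_gen_closed.

Record gen_alg := GenAlg { gen_val :> U; gen_valP : gen_val \in in_gen }.
HB.instance Definition _ := [isSub for gen_val].
HB.instance Definition _ := [Choice of gen_alg by <:].
HB.instance Definition _ := [SubChoice_isSubAlgebra of gen_alg by <:].

Lemma gen_memP (x : U) : Uq_gens x -> x \in in_gen.
Proof. by move=> gx; rewrite in_setE; apply: sub_subalg_gen. Qed.

Section Inclusion.
Variable phi : {lrmorphism U -> gen_alg}.
Definition incl_morph (x : U) : U := val (phi x).
Lemma incl_morph_linear : linear incl_morph.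
Proof. by move=> c x y; rewrite /incl_morph linearP. Qed.
Lemma incl_morph_monoid : GRing.monoid_morphism incl_morph.
Proof. by split=> [|x y]; rewrite /incl_morph ?rmorph1 ?rmorphM. Qed.
HB.instance Definition _ :=
  GRing.isLinear.Build C U U *:%R incl_morph incl_morph_linear.
HB.instance Definition _ :=
  GRing.isMonoidMorphism.Build U U incl_morph incl_morph_monoid.
End Inclusion.

(** The relations hold in the subalgebra on the generators, so it is a retract
    of [U]; uniqueness of the lift to [U] makes the retraction the identity. *)
Lemma Uq_generated : is_Uq a d q E F K K' -> forall x, subalg_gen Uq_gens x.
Proof.
move=> hU x.
have gE i : E i \in in_gen by apply: gen_memP; left; exists i.
have gF i : F i \in in_gen by apply: gen_memP; right; left; exists i.
have gK i : K i \in in_gen by apply: gen_memP; right; right; left; exists i.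
have gK' i : K' i \in in_gen by apply: gen_memP; right; right; right; exists i.
pose E1 i := GenAlg (gE i); pose F1 i := GenAlg (gF i).
pose K1 i := GenAlg (gK i); pose K1' i := GenAlg (gK' i).
have serre_val (X : 'I_n -> gen_alg) (Y : 'I_n -> U) i j :
    (forall k, val (X k) = Y k) -> serre_rel a d q Y i j -> serre_rel a d q X i j.
  move=> XY; rewrite /serre_rel => Y0; apply/val_inj; rewrite [RHS]/= -[RHS]Y0.
  rewrite (raddf_sum (val : gen_alg -> U)); apply: eq_bigr => r _.
  have valX k t : val (X k ^+ t) = Y k ^+ t.
    by rewrite -XY; elim: t => // t IH; rewrite !exprS -IH.
  by rewrite -!valX -XY.
have rel1 : Uq_relations a d q E1 F1 K1 K1'.
  have [[rKV rKK rKE rKF rEF rSE rSF] _ _] := hU; split.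
  - by move=> i; have [r1 r2] := rKV i; split; apply/val_inj.
  - by move=> i j; apply/val_inj/rKK.
  - by move=> i j; apply/val_inj/rKE.
  - by move=> i j; apply/val_inj/rKF.
  - by move=> i j; apply/val_inj; have := rEF i j; case: eqP.
  - by move=> i j ij; apply: serre_val (rSE i j ij).
  - by move=> i j ij; apply: serre_val (rSF i j ij).
have [phi phiE] := Uq_lift hU rel1.
have := Uq_lift_uniq hU (phi := incl_morph phi)
  (psi := @idfun U).
move=> /(_ _ x) /= <-; first by have := gen_valP (phi x); rewrite in_setE.
by move=> i; rewrite /incl_morph; have [-> -> -> ->] := phiE i.
Qed.

End Generation.

Section Weights.
Variables (C : fieldType) (n : nat) (a : 'M[int]_n) (d : 'I_n -> nat) (q : C).
Hypotheses (q_neq0 : q != 0)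
  (q_not_root : forall m : nat, (0 < m)%N -> q ^+ m != 1).
Hypothesis nondeg : forall g : 'rV[int]_n,
  (forall i, root_form a d (simple_root i) g = 0) -> g = 0.
Variables (U : algType C) (E F K K' : 'I_n -> U).
Hypothesis rel : nonserre_relations a d q E F K K'.

Local Notation Uw := (Uweight a d q K K').

Definition wchar i (g : 'rV[int]_n) : C := q ^ root_form a d (simple_root i) g.

Lemma root_formD x g h : root_form a d x (g + h) = root_form a d x g + root_form a d x h.
Proof. by rewrite /root_form linearD mulmxDr mxE. Qed.

Lemma root_formN x g : root_form a d x (- g) = - root_form a d x g.
Proof. by rewrite /root_form linearN mulmxN mxE. Qed.

Lemma root_form_simple i j :
  root_form a d (simple_root i) (simple_root j) = (d i)%:Z * a i j.
Proof.
rewrite /root_form /simple_root -rowE trmx_delta -colE !mxE.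
by [].
Qed.

Lemma wcharD i g h : wchar i (g + h) = wchar i g * wchar i h.
Proof. by rewrite /wchar root_formD expfzDr. Qed.

Lemma wchar0 i : wchar i 0 = 1.
Proof. by rewrite /wchar /root_form trmx0 mulmx0 mxE. Qed.

(** The weight spaces of different elements of the root lattice have different
    systems of eigenvalues. *)
Lemma wchar_inj g h : (forall i, wchar i g = wchar i h) -> g = h.
Proof.
move=> gh; apply/eqP; rewrite -subr_eq0; apply/eqP/nondeg => i.
have : q ^ root_form a d (simple_root i) (g - h) = 1.
  rewrite root_formD root_formN expfzDr // -invr_expz.
  by have := gh i; rewrite /wchar => ->; rewrite divff // expfz_neq0.
case: (root_form _ _ _ _) => m.
  by case: m => // m /eqP; rewrite -exprnP (negPf (q_not_root _)).
by rewrite NegzE -exprnN => /eqP; rewrite invr_eq1 (negPf (q_not_root _)).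
Qed.

Lemma Uweight_subspace g : subspace (Uw g).
Proof.
split=> [i|c x y gx gy i]; first by rewrite mulr0 mul0r scaler0.
rewrite mulrDr mulrDl -scalerAr -scalerAl gx gy.
by rewrite scalerDr !scalerA mulrC.
Qed.

Lemma UweightM g h x y : Uw g x -> Uw h y -> Uw (g + h) (x * y).
Proof.
move=> gx hy i; have [_ K2] := ns_KV rel i.
have -> : K i * (x * y) * K' i = (K i * x * K' i) * (K i * y * K' i).
  by rewrite -!mulrA (mulrA (K' i)) K2 mul1r.
rewrite gx hy -scalerAr -scalerAl scalerA.
by rewrite -[RHS]/(wchar i (g + h) *: _) wcharD mulrC.
Qed.

Lemma Uweight_unit : Uw 0 1.
Proof.
by move=> i; have [K1 _] := ns_KV rel i; rewrite mulr1 K1 -/(wchar i 0) wchar0 scale1r.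
Qed.

Lemma qiz_wchar i j : (q ^+ d i) ^ a i j = wchar i (simple_root j).
Proof. by rewrite /wchar root_form_simple exprnP exprz_exp. Qed.

Lemma UweightE j : Uw (simple_root j) (E j).
Proof. by move=> i; rewrite (ns_KE rel) qiz_wchar. Qed.

Lemma UweightF j : Uw (- simple_root j) (F j).
Proof.
by move=> i; rewrite (ns_KF rel) -invr_expz qiz_wchar invr_expz -root_formN.
Qed.

Lemma Uweight_monE v : Uw (content v) (monE E v).
Proof.
elim: v => [|j v IH]; rewrite /monE /content ?big_nil; first exact: Uweight_unit.
by rewrite !big_cons; apply: UweightM => //; apply: UweightE.
Qed.

Lemma Uweight_monF v : Uw (- content v) (monF F v).
Proof.
elim: v => [|j v IH].
  by rewrite /monF /content /rev /= !big_nil oppr0; apply: Uweight_unit.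
rewrite -cat1s content_cat monF_cat opprD addrC.
apply: UweightM => //; rewrite /content /monF /rev /= !big_seq1.
exact: UweightF.
Qed.

(** A vector of weight [g] that is a sum of vectors of other weights vanishes:
    subtracting from the conjugation by some [K i] its eigenvalue on one of the
    summands removes that summand. *)
Lemma weight_sep (g : 'rV[int]_n) (s : seq ('rV[int]_n * U)) t :
  Uw g t -> (forall p, p \in s -> Uw p.1 p.2 /\ p.1 != g) ->
  t = \sum_(p <- s) p.2 -> t = 0.
Proof.
move: {-1}(size s) (erefl (size s)) => m.
elim: m s t => [|m IH] [|p0 s] t //=; first by move=> _ _ _; rewrite big_nil.
move=> [sm] gt sP tE.
have [w0 ne0] := sP p0 (mem_head _ _).
have [i ne] : exists i, wchar i p0.1 != wchar i g.
  apply: contrapT => nex; move/eqP: ne0; apply; apply: wchar_inj => i.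
  by apply/eqP; apply: contrapT => /negP ne; apply: nex; exists i.
pose c (p : 'rV[int]_n * U) := wchar i p.1 - wchar i p0.1.
pose s' := [seq (p.1, c p *: p.2) | p : 'rV[int]_n * U <- s].
have Tt : (wchar i g - wchar i p0.1) *: t = \sum_(p <- s') p.2.
  rewrite scalerBl -[wchar i g *: t]gt {1}tE mulr_sumr mulr_suml.
  rewrite tE scaler_sumr -sumrB big_cons.
  have [-> _] := sP p0 (mem_head _ _); rewrite subrr add0r big_map.
  apply: eq_big_seq => p ps; rewrite /c scalerBl.
  by have [-> _] := sP p (mem_behead (s := p0 :: s) ps).
have /eqP : (wchar i g - wchar i p0.1) *: t = 0.
  apply: (IH s') => //; first by rewrite size_map.
    by apply: subspaceZ gt; apply: Uweight_subspace.
  move=> _ /mapP[p ps ->] /=; have [wp np] := sP p (mem_behead (s := p0 :: s) ps).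
  by split=> //; apply: subspaceZ wp; apply: Uweight_subspace.
by rewrite scaler_eq0 subr_eq0 eq_sym (negPf ne) => /eqP.
Qed.

(** The parts of weight other than [g] cancel by [weight_sep], so a span of
    weight vectors is a graded subspace. *)
Lemma lspan_weight (A : set U) g x :
  (forall y, A y -> exists h, Uw h y) -> lspan A x -> Uw g x ->
  lspan (A `&` Uw g) x.
Proof.
move=> Aw Ax gx.
pose P x := exists y (s : seq ('rV[int]_n * U)),
  [/\ lspan (A `&` Uw g) y, forall p, p \in s -> Uw p.1 p.2 /\ p.1 != g
    & x = y + \sum_(p <- s) p.2].
have AgS := lspan_subspace (A `&` Uw g).
have [y [s [Ay sP xE]]] : P x.
  apply: lspan_sub Ax => [|y Ay].
    split=> [|c x1 x2 [y1 [s1 [A1 P1 ->]]] [y2 [s2 [A2 P2 ->]]]].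
      by exists 0, [::]; split=> //; [case: AgS|rewrite big_nil addr0].
    exists (c *: y1 + y2), ([seq (p.1, c *: p.2) | p : 'rV[int]_n * U <- s1] ++ s2).
    split; first by case: AgS => _; apply.
      move=> p; rewrite mem_cat => /orP[/mapP[r rs ->] /=|/P2 //].
      have [wr nr] := P1 r rs.
      by split=> //; apply: subspaceZ wr; apply: Uweight_subspace.
    rewrite big_cat big_map /= -scaler_sumr scalerDr -!addrA; congr (_ + _).
    by rewrite addrCA.
  have [h hy] := Aw y Ay; have [hg|hg] := eqVneq h g.
    exists y, [::]; split=> //; last by rewrite big_nil addr0.
    by apply: sub_lspan; split=> //; rewrite -hg.
  exists 0, [:: (h, y)]; split; first by case: AgS.
    by move=> p; rewrite inE => /eqP ->.
  by rewrite big_seq1 add0r.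
suff xy0 : x - y = 0 by rewrite -[x](subrK y) xy0 add0r.
apply: (@weight_sep g s) => //; last by rewrite xE addrC addKr.
apply: (subspaceB (Uweight_subspace g) gx).
have : lspan (A `&` Uw g) `<=` Uw g.
  by apply: lspan_sub => [|z []//]; apply: Uweight_subspace.
exact.
Qed.

End Weights.
(** * Triangular monomials and their products *)

Section Triangular.
Variables (C : fieldType) (n : nat) (a : 'M[int]_n) (d : 'I_n -> nat) (q : C).
Hypotheses (q_neq0 : q != 0)
  (q_not_root : forall m : nat, (0 < m)%N -> q ^+ m != 1).
Hypothesis nondeg : forall g : 'rV[int]_n,
  (forall i, root_form a d (simple_root i) g = 0) -> g = 0.
Variables (U : algType C) (E F K K' : 'I_n -> U).
Hypothesis rel : nonserre_relations a d q E F K K'.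

Local Notation Uw := (Uweight a d q K K').
Local Notation U0 := (Ucartan K K').
Local Notation mE := (monE E).
Local Notation mF := (monF F).
Local Notation wch := (wchar a d q).

Lemma cartan_subspace : subspace U0. Proof. exact: subalg_gen_subspace. Qed.
Lemma cartan_unit : U0 1. Proof. by case: (subalg_gen_submonoid (range K `|` range K')). Qed.
Lemma cartanM x y : U0 x -> U0 y -> U0 (x * y).
Proof. by case: (subalg_gen_submonoid (range K `|` range K')) => _; apply. Qed.
Lemma cartanK i : U0 (K i). Proof. by apply: sub_subalg_gen; left; exists i. Qed.
Lemma cartanK' i : U0 (K' i). Proof. by apply: sub_subalg_gen; right; exists i. Qed.

Lemma wchar_neq0 i g : wch i g != 0. Proof. exact: expfz_neq0. Qed.

Lemma K_comm h x i : Uw h x -> K i * x = wch i h *: (x * K i).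
Proof.
move=> hx; have [_ K2] := ns_KV rel i.
by rewrite scalerAl /wchar -hx -(mulrA (K i * x)) K2 mulr1.
Qed.

Lemma K'_comm h x i : Uw h x -> K' i * x = (wch i h)^-1 *: (x * K' i).
Proof.
move=> hx; have [K1 K2] := ns_KV rel i.
have -> : x = (wch i h)^-1 *: (K i * x * K' i).
  by rewrite hx scalerA mulVf ?scale1r // wchar_neq0.
rewrite -scalerAr -scalerAl !mulrA K2 mul1r; congr (_ *: _).
by rewrite hx -scalerAl scalerA mulVf ?scale1r // wchar_neq0.
Qed.

Lemma cartan_right h x : Uw h x ->
  forall u, U0 u -> exists2 u', U0 u' & u * x = x * u'.
Proof.
move=> hx; apply: (@subalg_gen_sub _ _ _ [set u | exists2 u', U0 u' & u * x = x * u']).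
- split; first by exists 0; [case: cartan_subspace|rewrite mul0r mulr0].
  move=> c u1 u2 [v1 V1 e1] [v2 V2 e2]; exists (c *: v1 + v2).
    by case: cartan_subspace => _; apply.
  by rewrite mulrDl mulrDr -scalerAl -scalerAr e1 e2.
- split; first by exists 1; [apply: cartan_unit|rewrite mul1r mulr1].
  move=> u1 u2 [v1 V1 e1] [v2 V2 e2]; exists (v1 * v2); first exact: cartanM.
  by rewrite -mulrA e2 mulrA e1 mulrA.
- move=> u [[i _ <-]|[i _ <-]].
    exists (wch i h *: K i); first by apply: (subspaceZ _ cartan_subspace); apply: cartanK.
    by rewrite (K_comm _ hx) scalerAr.
  exists ((wch i h)^-1 *: K' i).
    by apply: (subspaceZ _ cartan_subspace); apply: cartanK'.
  by rewrite (K'_comm _ hx) scalerAr.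
Qed.

Lemma cartan_left h x : Uw h x ->
  forall u, U0 u -> exists2 u', U0 u' & x * u = u' * x.
Proof.
move=> hx; apply: (@subalg_gen_sub _ _ _ [set u | exists2 u', U0 u' & x * u = u' * x]).
- split; first by exists 0; [case: cartan_subspace|rewrite mul0r mulr0].
  move=> c u1 u2 [v1 V1 e1] [v2 V2 e2]; exists (c *: v1 + v2).
    by case: cartan_subspace => _; apply.
  by rewrite mulrDl mulrDr -scalerAl -scalerAr e1 e2.
- split; first by exists 1; [apply: cartan_unit|rewrite mul1r mulr1].
  move=> u1 u2 [v1 V1 e1] [v2 V2 e2]; exists (v1 * v2); first exact: cartanM.
  by rewrite mulrA e1 -mulrA e2 mulrA.
- move=> u [[i _ <-]|[i _ <-]].
    exists ((wch i h)^-1 *: K i).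
      by apply: (subspaceZ _ cartan_subspace); apply: cartanK.
    by rewrite -scalerAl (K_comm _ hx) scalerA mulVf ?scale1r // wchar_neq0.
  exists (wch i h *: K' i); first by apply: (subspaceZ _ cartan_subspace); apply: cartanK'.
  by rewrite -scalerAl (K'_comm _ hx) scalerA divff ?scale1r // wchar_neq0.
Qed.

Lemma cartan_weight : U0 `<=` Uw 0.
Proof.
apply: subalg_gen_sub; first exact: Uweight_subspace.
  split; first exact: (Uweight_unit rel).
  by move=> x y x0 y0; have := UweightM q_neq0 rel x0 y0; rewrite addr0.
have w1 i : q ^ root_form a d (simple_root i) 0 = 1.
  by rewrite -/(wchar a d q i 0) wchar0.
move=> u [[j _ <-]|[j _ <-]] i; have [K1 _] := ns_KV rel i; rewrite w1 scale1r.
  by rewrite (ns_KK rel) -mulrA K1 mulr1.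
by rewrite (ns_KK' rel) -mulrA K1 mulr1.
Qed.

(** Spans of triangular monomials subject to a condition on their two degrees;
    all the subspaces of [U] in question are of this form. *)
Definition tri_mon (P : 'rV[int]_n -> 'rV[int]_n -> Prop) : set U :=
  [set x | exists v u w,
     [/\ P (content v) (content w), U0 u & x = mE v * u * mF w]].

Definition tri P := lspan (tri_mon P).

Lemma tri_subspace P : subspace (tri P). Proof. exact: lspan_subspace. Qed.

Lemma tri_gen (P : 'rV[int]_n -> 'rV[int]_n -> Prop) v u w :
  P (content v) (content w) -> U0 u -> tri P (mE v * u * mF w).
Proof. by move=> Pvw u0; apply: sub_lspan; exists v, u, w. Qed.

Lemma tri_sub (P Q : 'rV[int]_n -> 'rV[int]_n -> Prop) :
  (forall v w : seq 'I_n, P (content v) (content w) -> Q (content v) (content w)) ->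
  tri P `<=` tri Q.
Proof.
move=> PQ; apply: lspan_sub; first exact: tri_subspace.
by move=> _ [v [u [w [Pvw u0 ->]]]]; apply: tri_gen => //; apply: PQ.
Qed.

Lemma monE_cat v w : mE (v ++ w) = mE v * mE w.
Proof. by rewrite /monE big_cat. Qed.

Lemma monE_nil : mE [::] = 1. Proof. by rewrite /monE big_nil. Qed.
Lemma monF_nil : mF [::] = 1. Proof. by rewrite /monF /rev /= big_nil. Qed.
Lemma monE1 i : mE [:: i] = E i. Proof. by rewrite /monE big_seq1. Qed.
Lemma monF1 i : mF [:: i] = F i. Proof. by rewrite /monF /rev /= big_seq1. Qed.
Lemma content_nil : content [::] = 0 :> 'rV[int]_n. Proof. by rewrite /content big_nil. Qed.
Lemma content1 (i : 'I_n) : content [:: i] = simple_root i.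
Proof. by rewrite /content big_seq1. Qed.

Lemma content_count (v : seq 'I_n) i : content v 0 i = (count_mem i v)%:Z.
Proof.
elim: v => [|j v IH]; first by rewrite content_nil mxE.
rewrite -cat1s content_cat content1 mxE IH /simple_root mxE eqxx /=.
by rewrite PoszD [i == j]eq_sym; case: (j == i).
Qed.

Lemma content_Qplus (v : seq 'I_n) : Qplus (content v).
Proof. by move=> i; rewrite content_count. Qed.

(** Only the letters [i] of [v] contribute to the commutator; each of them is
    replaced by an element of [U^0], which is then moved to the right end. *)
Lemma F_monE i v :
  lspan [set x | exists v' u, [/\ content v' = content v - simple_root i, U0 u
                                & x = mE v' * u]]
        (F i * mE v - mE v * F i).
Proof.
elim: v => [|j v IH].
  by rewrite monE_nil mulr1 mul1r subrr; apply: lspan0.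
rewrite -cat1s monE_cat monE1 content_cat content1.
have -> : F i * (E j * mE v) - E j * mE v * F i =
    - ((E j * F i - F i * E j) * mE v) + E j * (F i * mE v - mE v * F i).
  by rewrite mulrBl mulrBr opprB !mulrA addrA subrK.
apply: (subspaceD (lspan_subspace _)).
  apply: (subspaceN (lspan_subspace _)).
  rewrite (ns_EF rel); case: eqP => [->|_]; last first.
    by rewrite mul0r; apply: lspan0.
  have uK : U0 ((q ^+ d i - (q ^+ d i)^-1)^-1 *: (K i - K' i)).
    apply: (subspaceZ _ cartan_subspace); apply: (subspaceB cartan_subspace).
      exact: cartanK.
    exact: cartanK'.
  have [u' u0' ->] := cartan_right (Uweight_monE q_neq0 rel v) uK.
  by apply: sub_lspan; exists v, u'; split=> //; rewrite addrAC subrr add0r.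
apply: (lspan_linear (linear_mull (E j)) (lspan_subspace _)) IH.
move=> _ [v' [u [cv u0 ->]]]; apply: sub_lspan; exists (j :: v'), u; split=> //.
  by rewrite -cat1s content_cat content1 cv addrA.
by rewrite -cat1s monE_cat monE1 mulrA.
Qed.

Lemma F_tri i (P Q : 'rV[int]_n -> 'rV[int]_n -> Prop) :
  (forall g h, P g h -> Q g (h + simple_root i) /\ Q (g - simple_root i) h) ->
  forall x, tri P x -> tri Q (F i * x).
Proof.
move=> PQ x.
apply: (lspan_linear (linear_mull (F i)) (tri_subspace Q)).
move=> _ [v [u [w [Pvw u0 ->]]]]; have [Q1 Q2] := PQ _ _ Pvw.
have -> : F i * (mE v * u * mF w) =
    (F i * mE v - mE v * F i) * (u * mF w) + mE v * F i * u * mF w.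
  by rewrite mulrBl !mulrA subrK.
apply: (subspaceD (tri_subspace _)).
  apply: (lspan_linear (linear_mulr (u * mF w)) (tri_subspace Q) _ (@F_monE i v)).
  move=> _ [v' [u' [cv u0' ->]]]; rewrite mulrA -(mulrA (mE v')).
  by apply: tri_gen; [rewrite cv|apply: cartanM].
rewrite -(mulrA (mE v)).
have [u' u0' ->] := cartan_left (UweightF rel i) u0.
have -> : mE v * (u' * F i) * mF w = mE v * u' * mF (w ++ [:: i]).
  by rewrite monF_cat monF1 !mulrA.
by apply: tri_gen => //; rewrite content_cat content1.
Qed.

(** The span of all triangular monomials contains [1] and is stable under left
    multiplication by the generators. *)
Lemma tri_all : (forall x, subalg_gen (Uq_gens E F K K') x) ->
  forall x, tri (fun _ _ => True) x.
Proof.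
move=> gen x; set T := tri _.
have TS : subspace T := tri_subspace _.
have T1 : T 1.
  have -> : 1 = mE [::] * 1 * mF [::] by rewrite monE_nil monF_nil !mulr1.
  by apply: tri_gen => //; apply: cartan_unit.
suff H : forall y, T y -> T (x * y) by rewrite -[x]mulr1; apply: H.
move: x (gen x).
apply: (@subalg_gen_sub _ _ _ [set x | forall y, T y -> T (x * y)]).
- split=> [y _|c x1 x2 H1 H2 y Ty]; first by rewrite mul0r; case: TS.
  by rewrite mulrDl -scalerAl; case: TS => _; apply; [apply: H1|apply: H2].
- split=> [y|x1 x2 H1 H2 y Ty]; first by rewrite mul1r.
  by rewrite -mulrA; apply: H1; apply: H2.
have cart u : U0 u -> forall y, T y -> T (u * y).
  move=> u0 y; apply: (lspan_linear (linear_mull u) TS).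
  move=> _ [v [u1 [w [_ u01 ->]]]]; rewrite !mulrA.
  have [u' u0' ->] := cartan_right (Uweight_monE q_neq0 rel v) u0.
  by rewrite -(mulrA (mE v)); apply: tri_gen => //; apply: cartanM.
move=> _ [[i _ <-]|[[i _ <-]|[[i _ <-]|[i _ <-]]]] y.
- apply: (lspan_linear (linear_mull (E i)) TS).
  move=> _ [v [u1 [w [_ u01 ->]]]]; rewrite !mulrA.
  by rewrite -monE1 -monE_cat; apply: tri_gen.
- by apply: F_tri.
- by apply: cart; apply: cartanK.
- by apply: cart; apply: cartanK'.
Qed.

(** Reordering [F_w E_v] lowers both degrees by the same element of [Q^+]. *)
Lemma monF_monE v w :
  tri (fun g h => exists2 k, Qplus k & g = content v - k /\ h = content w - k)
      (mF w * mE v).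
Proof.
elim/last_ind: w => [|w i IH].
  have -> : mF [::] * mE v = mE v * 1 * mF [::] by rewrite monF_nil mul1r !mulr1.
  apply: tri_gen; last exact: cartan_unit.
  by exists 0; [move=> i; rewrite mxE|rewrite !subr0].
rewrite -cats1 monF_cat monF1 content_cat content1 -mulrA.
apply: F_tri IH => g h [k kp [-> ->]]; split.
  by exists k => //; split=> //; rewrite addrAC.
exists (k + simple_root i).
  by move=> j; rewrite mxE addr_ge0 // -content1; apply: content_Qplus.
by rewrite !opprD !addrA; split=> //; rewrite [_ + _ - k]addrAC addrK.
Qed.

(** Reordering the two inner factors loses a degree [k] with [0 <= k <= g] and
    [k <= h], so that the degree of the result is [g + h - k]. *)
Lemma tri_mul g h x y :
  tri (fun g1 g2 => g1 = g /\ g2 = g) x -> tri (fun g1 g2 => g1 = h /\ g2 = h) y ->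
  tri (fun g1 g2 => g1 = g2 /\ forall i,
         [/\ g 0 i <= g1 0 i, h 0 i <= g1 0 i & g1 0 i <= g 0 i + h 0 i]) (x * y).
Proof.
set Q := (fun _ _ => _ /\ _) => gx hy; move: x y gx hy.
apply: lspan_mul; first exact: tri_subspace.
move=> _ _ [v [u [w [[vg wg] u0 ->]]]] [v' [u' [w' [[vh wh] u0' ->]]]].
have -> : mE v * u * mF w * (mE v' * u' * mF w') =
    mE v * u * (mF w * mE v') * (u' * mF w') by rewrite !mulrA.
apply: (@lspan_linear _ _ _ _ (fun z => mE v * u * z * (u' * mF w'))) (@monF_monE v' w).
- by move=> c y1 y2; rewrite linear_mull linear_mulr.
- exact: tri_subspace.
move=> _ [v1 [u1 [w1 [[k kp [e1 e2]] u01 ->]]]].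
have [u2 u02 eu2] := cartan_right (Uweight_monE q_neq0 rel v1) u0.
have [u3 u03 eu3] := cartan_left (Uweight_monF q_neq0 rel w1) u0'.
have -> : mE v * u * (mE v1 * u1 * mF w1) * (u' * mF w') =
   mE (v ++ v1) * (u2 * u1 * u3) * mF (w' ++ w1).
  rewrite monE_cat monF_cat -!mulrA (mulrA u) eu2 -!mulrA; do 4 congr (_ * _).
  by rewrite mulrA eu3 mulrA.
apply: tri_gen; last by do 2?apply: cartanM.
rewrite !content_cat e1 e2 vg wg vh wh; split; first by rewrite addrCA.
move=> i; have := content_Qplus v1 i; have := content_Qplus w1 i.
have := kp i; rewrite e1 e2 vh wg !mxE.
move: (g 0 i) (h 0 i) (k 0 i) => r1 r2 r3 r3p p1 p2; split; lia.
Qed.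

End Triangular.
(** * The degree decomposition of the weight zero part *)

Section Degrees.
Variables (C : fieldType) (n : nat) (a : 'M[int]_n) (d : 'I_n -> nat) (q : C).
Hypotheses (q_neq0 : q != 0)
  (q_not_root : forall m : nat, (0 < m)%N -> q ^+ m != 1).
Hypothesis nondeg : forall g : 'rV[int]_n,
  (forall i, root_form a d (simple_root i) g = 0) -> g = 0.
Variables (U : algType C) (E F K K' : 'I_n -> U).
Hypothesis rel : nonserre_relations a d q E F K K'.

Local Notation Uw := (Uweight a d q K K').
Local Notation U0 := (Ucartan K K').
Local Notation mE := (monE E).
Local Notation mF := (monF F).
Local Notation tri := (tri E F K K').
Local Notation Uz := (Uzero a d q E F K K').

Lemma Uweight_inter0 g h x : Uw g x -> Uw h x -> g != h -> x = 0.
Proof.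
move=> gx hx gh; apply: (weight_sep q_neq0 q_not_root nondeg (s := [:: (h, x)]) gx).
  by move=> p; rewrite inE => /eqP -> /=; split=> //; rewrite eq_sym.
by rewrite big_seq1.
Qed.

(** A homogeneous part of the span of monomials is spanned by the monomials of
    that degree; a monomial of another degree lying in it is zero. *)
Lemma mon_weight_span (mon : seq 'I_n -> U) (wt : seq 'I_n -> 'rV[int]_n) g :
  (forall v, Uw (wt v) (mon v)) ->
  lspan (range mon) `&` Uw g `<=` lspan [set x | exists2 v, wt v = g & x = mon v].
Proof.
move=> mw x [xs gx].
have yw y : range mon y -> exists h, Uw h y by move=> [v _ <-]; exists (wt v).
have := lspan_weight q_neq0 q_not_root nondeg yw xs gx.
apply: lspan_sub => [|y [[v _ <-] gv]]; first exact: lspan_subspace.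
have [vg|vg] := eqVneq (wt v) g; first by apply: sub_lspan; exists v.
by rewrite (Uweight_inter0 (mw v) gv vg); apply: lspan0.
Qed.

Lemma Upos_span : Upos E `<=` lspan (range mE).
Proof.
apply: subalg_gen_sub; first exact: lspan_subspace.
  split; first by apply: sub_lspan; exists [::] => //; rewrite monE_nil.
  apply: lspan_mul; first exact: lspan_subspace.
  move=> _ _ [v _ <-] [w _ <-]; apply: sub_lspan; exists (v ++ w) => //.
  exact: monE_cat.
by move=> _ [i _ <-]; apply: sub_lspan; exists [:: i] => //; rewrite monE1.
Qed.

Lemma Uneg_span : Uneg F `<=` lspan (range mF).
Proof.
apply: subalg_gen_sub; first exact: lspan_subspace.
  split; first by apply: sub_lspan; exists [::] => //; rewrite monF_nil.
  apply: lspan_mul; first exact: lspan_subspace.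
  move=> _ _ [v _ <-] [w _ <-]; apply: sub_lspan; exists (w ++ v) => //.
  exact: monF_cat.
by move=> _ [i _ <-]; apply: sub_lspan; exists [:: i] => //; rewrite monF1.
Qed.

Lemma monE_Upos v : Upos E (mE v).
Proof.
have [G1 GM] := subalg_gen_submonoid (range E).
elim: v => [|i v IH]; first by rewrite monE_nil.
rewrite -cat1s monE_cat monE1; apply: GM IH.
by apply: sub_subalg_gen; exists i.
Qed.

Lemma monF_Uneg v : Uneg F (mF v).
Proof.
have [G1 GM] := subalg_gen_submonoid (range F).
elim: v => [|i v IH]; first by rewrite monF_nil.
rewrite -cat1s monF_cat monF1; apply: GM IH _.
by apply: sub_subalg_gen; exists i.
Qed.

Lemma Uzero_tri g : Uz g = tri (fun h1 h2 => h1 = g /\ h2 = g).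
Proof.
apply/seteqP; split; last first.
  apply: lspan_sub; first exact: lspan_subspace.
  move=> _ [v [u [w [[vg wg] u0 ->]]]]; apply: sub_lspan.
  exists (mE v * u); [apply: sub_lspan; exists (mE v); last by exists u|exists (mF w)] => //.
    split; first exact: monE_Upos.
    by rewrite -vg; apply: (Uweight_monE q_neq0 rel).
  split; first exact: monF_Uneg.
  by rewrite -wg; apply: (Uweight_monF q_neq0 rel).
apply: lspan_sub; first exact: lspan_subspace.
move=> _ [x Ax [y [yn yg] <-]].
set V := tri _.
pose mEU := [set x | exists v u, [/\ content v = g, U0 u & x = mE v * u]].
have {Ax}xs : lspan mEU x.
  move: Ax; apply: lspan_sub; first exact: lspan_subspace.
  move=> _ [e [ep eg] [u u0 <-]].
  have es := mon_weight_span (Uweight_monE q_neq0 rel) (conj (Upos_span ep) eg).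
  apply: lspan_mul es (sub_lspan u0); first exact: lspan_subspace.
  by move=> _ u' [v vg ->] u0'; apply: sub_lspan; exists v, u'.
have ys := mon_weight_span (Uweight_monF q_neq0 rel) (conj (Uneg_span yn) yg).
apply: lspan_mul xs ys; first exact: lspan_subspace.
move=> _ _ [v [u [vg u0 ->]]] [w wg ->]; apply: tri_gen => //; split=> //.
exact: oppr_inj.
Qed.

Lemma sumsp_tri (P : set 'rV[int]_n) :
  sumsp P Uz = tri (fun h1 h2 => h1 = h2 /\ P h1).
Proof.
apply/seteqP; split.
  apply: lspan_sub; first exact: lspan_subspace.
  move=> x [g Pg]; rewrite Uzero_tri.
  by apply: tri_sub => v w [-> ->].
apply: lspan_sub; first exact: lspan_subspace.
move=> x [v [u [w [[vw Pv] u0 ->]]]]; apply: sub_lspan; exists (content v) => //.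
by rewrite Uzero_tri; apply: tri_gen.
Qed.

Section Projections.
Hypothesis tproj : forall g, exists p : U -> U, linear p /\
    forall v u w, Ucartan K K' u ->
      p (mE v * u * mF w) = if content w == g then mE v * u * mF w else 0.

Let pr g := sval (cid (tproj g)).

Lemma pr_linear g : linear (pr g).
Proof. by rewrite /pr; case: cid => p []. Qed.

Lemma pr_mon g v u w : U0 u ->
  pr g (mE v * u * mF w) = if content w == g then mE v * u * mF w else 0.
Proof. by rewrite /pr; case: cid => p [_ /= pE]; apply: pE. Qed.

Lemma pr_tri (P : 'rV[int]_n -> 'rV[int]_n -> Prop) g x :
  (forall v w : seq 'I_n, P (content v) (content w) -> content w != g) -> tri P x -> pr g x = 0.
Proof.
move=> Pg; apply: (@lspan_sub _ _ _ [set x | pr g x = 0]).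
  split; first by have := scalable_linear (pr_linear g) 0 0; rewrite /= !scale0r.
  by move=> c y z py pz; rewrite /= pr_linear py pz scaler0 addr0.
move=> _ [v [u [w [Pvw u0 ->]]]].
by rewrite /= pr_mon // (negPf (Pg _ _ Pvw)).
Qed.

Lemma pr_id g x : tri (fun h1 h2 => h1 = g /\ h2 = g) x -> pr g x = x.
Proof.
apply: (@lspan_sub _ _ _ [set x | pr g x = x]).
  split; first by have := scalable_linear (pr_linear g) 0 0; rewrite /= !scale0r.
  by move=> c y z py pz; rewrite /= pr_linear py pz.
move=> _ [v [u [w [[vg wg] u0 ->]]]].
by rewrite /= pr_mon // wg eqxx.
Qed.

(** The projection of degree [i] isolates the summand of index [i]. *)
Lemma Uzero_direct (P : set 'rV[int]_n) : direct P Uz.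
Proof.
move=> s x us sP sum0 i is_.
have xz j : j \in s -> tri (fun h1 h2 => h1 = j /\ h2 = j) (x j).
  by move=> js; rewrite -Uzero_tri; have [] := sP j js.
have prs (r : seq 'rV[int]_n) : pr i (\sum_(j <- r) x j) = \sum_(j <- r) pr i (x j).
  elim: r => [|j r IH].
    by rewrite !big_nil; have := scalable_linear (pr_linear i) 0 0; rewrite /= !scale0r.
  by rewrite !big_cons -IH -[X in pr i (X + _)]scale1r pr_linear scale1r.
have := congr1 (pr i) sum0; rewrite prs (bigD1_seq i) //= big1_seq.
  rewrite addr0 pr_id; last exact: xz.
  by have := scalable_linear (pr_linear i) 0 0; rewrite /= !scale0r => -> ->.
move=> j /andP[ji js]; apply: pr_tri (xz j js) => v w [_ ->].
exact: ji.
Qed.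

(** Every element is the finite sum of its components. *)
Lemma pr_inj (P : 'rV[int]_n -> 'rV[int]_n -> Prop) x :
  tri P x -> (forall g, pr g x = 0) -> x = 0.
Proof.
move=> xt x0.
have [s0 sE] : exists s0 : seq 'rV[int]_n, forall s, uniq s -> {subset s0 <= s} ->
    x = \sum_(g <- s) pr g x.
  move: xt {x0}; pose V := [set x | exists s0 : seq 'rV[int]_n, forall s, uniq s ->
    {subset s0 <= s} -> x = \sum_(g <- s) pr g x].
  apply: (@lspan_sub _ _ _ V).
    split.
      exists [::] => s _ _; rewrite big1 // => g _.
      by have := scalable_linear (pr_linear g) 0 0; rewrite /= !scale0r.
    move=> c y z [s1 H1] [s2 H2]; exists (s1 ++ s2) => s us ss.
    under eq_bigr => g _ do rewrite pr_linear.
    rewrite big_split -scaler_sumr /= -H1 -?H2 // => g gs; apply: ss;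
      by rewrite mem_cat gs ?orbT.
  move=> _ [v [u [w [_ u0 ->]]]]; exists [:: content w] => s us ss.
  have ws : content w \in s by apply: ss; rewrite mem_head.
  rewrite (bigD1_seq (content w)) //= big1 => [|g gw].
    by rewrite pr_mon // eqxx addr0.
  by rewrite pr_mon // eq_sym (negPf gw).
rewrite (sE (undup s0)) ?undup_uniq // => [|g]; last by rewrite mem_undup.
by rewrite big1.
Qed.

Lemma tri_inter0 (P Q : 'rV[int]_n -> 'rV[int]_n -> Prop) x :
  (forall g1 g2 h, P g1 h -> Q g2 h -> False) -> tri P x -> tri Q x -> x = 0.
Proof.
move=> PQ Px Qx; apply: pr_inj (Px) _ => g.
have [Qg|Qg] := pselect (exists h, Q h g).
  have [h hg] := Qg; apply: pr_tri Px => v w Pvw; apply/eqP => wg.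
  by apply: PQ hg; rewrite -wg; exact: Pvw.
apply: pr_tri Qx => v w Qvw; apply/eqP => wg; apply: Qg.
by exists (content v); rewrite -wg.
Qed.

End Projections.

(** A triangular monomial has weight the difference of its two degrees. *)
Lemma weight0_tri : (forall x, subalg_gen (Uq_gens E F K K') x) ->
  Uw 0 = tri (fun h1 h2 => h1 = h2).
Proof.
move=> gen.
have mw v u w : U0 u -> Uw (content v - content w) (mE v * u * mF w).
  move=> u0; rewrite -[content v]addr0; apply: (UweightM q_neq0 rel).
    apply: (UweightM q_neq0 rel); first exact: (Uweight_monE q_neq0 rel).
    exact: (cartan_weight q_neq0 rel).
  exact: (Uweight_monF q_neq0 rel).
apply/seteqP; split=> x; last first.
  apply: lspan_sub; first exact: Uweight_subspace.
  by move=> _ [v [u [w [vw u0 ->]]]]; have := mw v u w u0; rewrite vw subrr.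
move=> x0.
have yw y : tri_mon E F K K' (fun _ _ => True) y -> exists h, Uw h y.
  by move=> [v [u [w [_ u0 ->]]]]; exists (content v - content w); apply: mw.
have := lspan_weight q_neq0 q_not_root nondeg yw (@tri_all _ _ _ _ _ q_neq0 _ _ _ _ _ rel gen x) x0.
apply: lspan_sub; first exact: tri_subspace.
move=> _ [[v [u [w [_ u0 ->]]]] y0].
have [vw|vw] := eqVneq (content v - content w) 0.
  by apply: tri_gen => //; apply/eqP; rewrite -subr_eq0 vw.
by rewrite (Uweight_inter0 (mw v u w u0) y0 vw); apply: lspan0.
Qed.

(** * The subalgebra of an orthogonal set of simple roots *)

Section Orthogonal.
Variable S : {set 'I_n}.
Hypotheses (EE : forall i j, i \in S -> j \in S -> E i * E j = E j * E i)
  (FF : forall i j, i \in S -> j \in S -> F i * F j = F j * F i).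

Definition EFK : set U :=
  [set E i * F i | i in [set i | i \in S]] `|` (range K `|` range K').

Local Notation G := (subalg_gen EFK).

Lemma EF_comm i j : i != j -> E i * F j = F j * E i.
Proof. by move=> ij; apply/eqP; rewrite -subr_eq0 (ns_EF rel) (negPf ij). Qed.

Lemma cartan_EFK : U0 `<=` G.
Proof.
apply: subalg_gen_sub; [exact: subalg_gen_subspace|exact: subalg_gen_submonoid|].
by move=> x Kx; apply: sub_subalg_gen; right.
Qed.

Lemma EFK_EF i : i \in S -> G (E i * F i).
Proof. by move=> iS; apply: sub_subalg_gen; left; exists i. Qed.

Lemma EF_weight i : Uw 0 (E i * F i).
Proof.
have := UweightM q_neq0 rel (UweightE rel i) (UweightF rel i).
by rewrite subrr.
Qed.

(** Only the generator [E i * F i] needs care: moving [E i] past it costs an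
    element of [U^0], by the commutator of [E i] and [F i]. *)
Lemma E_EFK i : i \in S -> forall z, G z -> exists2 z', G z' & E i * z = z' * E i.
Proof.
move=> iS; have GS := subalg_gen_subspace EFK; have [G1 GM] := subalg_gen_submonoid EFK.
apply: (@subalg_gen_sub _ _ _ [set z | exists2 z', G z' & E i * z = z' * E i]).
- split; first by exists 0; [case: GS|rewrite mul0r mulr0].
  move=> c x y [x' Gx ex] [y' Gy ey]; exists (c *: x' + y'); first by case: GS => _; apply.
  by rewrite mulrDr mulrDl -scalerAr -scalerAl ex ey.
- split; first by exists 1; rewrite // mul1r mulr1.
  move=> x y [x' Gx ex] [y' Gy ey]; exists (x' * y'); first exact: GM.
  by rewrite mulrA ex -mulrA ey mulrA.
have cart u : U0 u -> exists2 z', G z' & E i * u = z' * E i.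
  move=> u0; have [u' u0' eu] := cartan_left q_neq0 rel (UweightE rel i) u0.
  by exists u' => //; apply: cartan_EFK.
move=> _ [[j /= jS <-]|[[j _ <-]|[j _ <-]]]; last 2 first.
- by apply: cart; apply: cartanK.
- by apply: cart; apply: cartanK'.
have [<-|ij] := eqVneq i j; last first.
  exists (E j * F j); first exact: EFK_EF.
  by rewrite mulrA EE // -mulrA EF_comm // mulrA.
have EFh : E i * F i = F i * E i + (E i * F i - F i * E i) by rewrite addrC subrK.
have hc : U0 (E i * F i - F i * E i).
  rewrite (ns_EF rel) eqxx; apply: (subspaceZ _ (cartan_subspace _ _)).
  by apply: (subspaceB (cartan_subspace _ _)); [apply: cartanK|apply: cartanK'].
have [z' Gz ez] := cart _ hc.
exists (E i * F i + z'); first by apply: (subspaceD GS) => //; apply: EFK_EF.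
by rewrite {1}EFh mulrDr ez mulrDl mulrA.
Qed.

(** A letter of [v] occurs in [w], and its factors [E i] and [F i] can be moved
    to the two ends of the monomial and then next to each other. *)
Lemma mon_EFK v u w : {subset v <= S} -> {subset w <= S} ->
  content v = content w -> U0 u -> G (mE v * u * mF w).
Proof.
have GS := subalg_gen_subspace EFK; have [G1 GM] := subalg_gen_submonoid EFK.
move=> vS wS vw u0; elim: v w vS wS vw => [|i v IH] w vS wS vw.
  have -> : w = [::].
    case: w {wS} vw => // j w /rowP/(_ j); rewrite !content_count /= eqxx => -[].
    by rewrite add1n.
  by rewrite monE_nil monF_nil mul1r mulr1; apply: cartan_EFK.
have iS : i \in S by apply: vS; rewrite mem_head.
have iw : i \in w.
  move/rowP/(_ i): vw; rewrite !content_count /= eqxx => -[cw].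
  by rewrite -has_pred1 has_count -cw.
case/splitPr: iw wS vw => w1 w2 wS vw.
have w1S j : j \in w1 -> j \in S by move=> jw; apply: wS; rewrite mem_cat jw.
have -> : mF (w1 ++ i :: w2) = mF (w1 ++ w2) * F i.
  rewrite -cat1s !monF_cat monF1 -!mulrA; congr (_ * _).
  elim: w1 w1S {wS vw} => [|j w1 IHw] w1S; first by rewrite monF_nil mul1r mulr1.
  rewrite -cat1s monF_cat monF1 mulrA IHw => [|k kw]; last first.
    by apply: w1S; rewrite inE kw orbT.
  by rewrite -!mulrA FF // w1S // mem_head.
have Gz : G (mE v * u * mF (w1 ++ w2)).
  apply: IH => [j jv|j jw|]; first by apply: vS; rewrite inE jv orbT.
    by apply: wS; move: jw; rewrite !mem_cat inE => /orP[] ->; rewrite ?orbT.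
  apply: (addrI (simple_root i)); rewrite -content1 -content_cat /= vw.
  by rewrite -[i :: w2]cat1s !content_cat addrCA.
have [z' Gz' ez] := E_EFK iS Gz.
rewrite -cat1s monE_cat monE1.
have -> : E i * mE v * u * (mF (w1 ++ w2) * F i) =
   E i * (mE v * u * mF (w1 ++ w2)) * F i by rewrite !mulrA.
by rewrite ez -mulrA; apply: GM => //; apply: EFK_EF.
Qed.

Lemma QplusS_content (v : seq 'I_n) : QplusS S (content v) <-> {subset v <= S}.
Proof.
split=> [[_ v0] i iv|vS].
  apply: contraT => iS; have := v0 i iS; rewrite content_count => -[] /eqP.
  by rewrite -leqn0 leqNgt -has_count has_pred1 iv.
split; first exact: content_Qplus.
move=> i iS; rewrite content_count; congr Posz; apply/count_memPn.
by apply: contra iS => /vS.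
Qed.

Lemma tri_EFK : tri (fun h1 h2 => h1 = h2 /\ QplusS S h1) `<=` G.
Proof.
apply: lspan_sub; first exact: subalg_gen_subspace.
move=> _ [v [u [w [[vw vS] u0 ->]]]]; apply: mon_EFK => //; apply/QplusS_content=> //.
by rewrite -vw.
Qed.

Lemma tri_unit (P : 'rV[int]_n -> 'rV[int]_n -> Prop) : P 0 0 -> tri P 1.
Proof.
move=> P0; have -> : 1 = mE [::] * 1 * mF [::] by rewrite monE_nil monF_nil !mulr1.
by apply: tri_gen; [rewrite content_nil|apply: cartan_unit].
Qed.

(** The degrees in a product are bounded above by the sum of the degrees, so
    no letter outside [S] appears. *)
Lemma triS_submonoid : submonoid (tri (fun h1 h2 => h1 = h2 /\ QplusS S h1)).
Proof.
split; first by apply: tri_unit; split=> //; split=> [i|i _]; rewrite mxE.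
apply: lspan_mul; first exact: tri_subspace.
move=> _ _ [v [u [w [[vw vS] u0 ->]]]] [v' [u' [w' [[vw' vS'] u0' ->]]]].
have t1 : tri (fun h1 h2 => h1 = content v /\ h2 = content v) (mE v * u * mF w).
  exact: tri_gen.
have t2 : tri (fun h1 h2 => h1 = content v' /\ h2 = content v') (mE v' * u' * mF w').
  exact: tri_gen.
apply: tri_sub (tri_mul q_neq0 rel t1 t2) => v1 w1 [<- H]; split=> //.
split; first exact: content_Qplus.
case: vS vS' => _ vS [_ vS'] i iS; have [_ _] := H i; rewrite vS // vS' // addr0 => le0.
by apply/eqP; rewrite eq_le le0 content_Qplus.
Qed.

Lemma triS_EFK : tri (fun h1 h2 => h1 = h2 /\ QplusS S h1) = G.
Proof.
apply/seteqP; split; first exact: tri_EFK.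
apply: subalg_gen_sub; [exact: tri_subspace|exact: triS_submonoid|].
have Kt u : U0 u -> tri (fun h1 h2 => h1 = h2 /\ QplusS S h1) u.
  move=> u0; have -> : u = mE [::] * u * mF [::] by rewrite monE_nil monF_nil mul1r mulr1.
  by apply: tri_gen => //; split=> //; apply/QplusS_content.
move=> _ [[i /= iS <-]|[[i _ <-]|[i _ <-]]]; last 2 first.
- by apply: Kt; apply: cartanK.
- by apply: Kt; apply: cartanK'.
have -> : E i * F i = mE [:: i] * 1 * mF [:: i] by rewrite monE1 monF1 mulr1.
apply: tri_gen; last exact: cartan_unit.
by split=> //; apply/QplusS_content => j; rewrite inE => /eqP ->.
Qed.

Lemma EFK_weight : EFK `<=` Uw 0.
Proof.
move=> x [[i /= iS <-]|Kx]; first exact: EF_weight.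
by apply: (cartan_weight q_neq0 rel); apply: sub_subalg_gen.
Qed.

Lemma weight0_comm x u : Uw 0 x -> (range K `|` range K') u -> x * u = u * x.
Proof.
move=> x0 [[i _ <-]|[i _ <-]]; first by rewrite (K_comm rel i x0) wchar0 scale1r.
by rewrite (K'_comm q_neq0 rel i x0) wchar0 invr1 scale1r.
Qed.

Lemma EFK_comm : forall x y, EFK x -> EFK y -> x * y = y * x.
Proof.
move=> x y Ex Ey.
have [[i /= iS ex]|Kx] := Ex; last by rewrite (weight0_comm (EFK_weight Ey) Kx).
have [[j /= jS ey]|Ky] := Ey; last exact: weight0_comm (EFK_weight Ex) Ky.
rewrite -{}ex -{}ey; have [->//|ij] := eqVneq i j.
have ji : j != i by rewrite eq_sym.
rewrite -mulrA (mulrA (F i)) -(EF_comm ji) !mulrA (EE iS jS).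
by rewrite -!mulrA (mulrA (F j)) -(EF_comm ij) -mulrA (FF iS jS).
Qed.

End Orthogonal.

(** The centralizer of a set is a subalgebra; this is used twice. *)
Lemma subalg_gen_comm (A : set U) :
  (forall x y, A x -> A y -> x * y = y * x) ->
  forall x y, subalg_gen A x -> subalg_gen A y -> x * y = y * x.
Proof.
move=> AA.
have cent (z : U) (B : set U) : (forall y, B y -> z * y = y * z) ->
    forall y, subalg_gen B y -> z * y = y * z.
  move=> zB; apply: (@subalg_gen_sub _ _ _ [set y | z * y = y * z]) => //.
    split; first by rewrite /= mulr0 mul0r.
    by move=> c x y zx zy; rewrite /= mulrDr mulrDl -scalerAr -scalerAl zx zy.
  split; first by rewrite /= mulr1 mul1r.
  by move=> x y zx zy; rewrite /= mulrA zx -mulrA zy mulrA.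
move=> x y Gx; apply: (cent x A) => z Az; apply/esym; move: x Gx.
by apply: (cent z A) => t At; apply: AA.
Qed.

End Degrees.
(** * Cartan data and the main result *)

Section CartanData.
Variables (R : realType) (n : nat) (a : 'M[int]_n) (d : 'I_n -> nat).
Hypothesis hcartan : cartan_datum a d R.

Lemma cartan_d_gt0 i : (0 < d i)%N.
Proof. by have := cartan_d hcartan i; rewrite !inE => /or3P[] /eqP ->. Qed.

Lemma cartan_sym i j : (d i)%:Z * a i j = (d j)%:Z * a j i.
Proof.
have [sym _] := cartan_posdef hcartan.
have /matrixP/(_ j i) := sym; rewrite !mxE => /eqP.
by rewrite eqr_int => /eqP.
Qed.

Lemma root_form_nondeg (g : 'rV[int]_n) :
  (forall i, root_form a d (simple_root i) g = 0) -> g = 0.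
Proof.
move=> g0; have Bg : sym_cartan a d *m g^T = 0.
  apply/matrixP => i j; rewrite ord1 [RHS]mxE -(g0 i) /root_form /simple_root.
  by rewrite -rowE -row_mul [RHS]mxE.
have [_ pos] := cartan_posdef hcartan.
pose x : 'rV[R]_n := map_mx intr g.
have x0 : x = 0.
  apply/eqP; apply: contraT => /pos; rewrite -mulmxA /x map_trmx -map_mxM Bg.
  by rewrite map_mx0 mulmx0 mxE ltxx.
apply/rowP => i; move/rowP/(_ i): x0; rewrite !mxE => /eqP.
by rewrite intr_eq0 => /eqP.
Qed.

End CartanData.

(** For [a i j = 0] the Serre element is the commutator. *)
Lemma serre_comm_of_zero (C : fieldType) (n : nat) (a : 'M[int]_n) (d : 'I_n -> nat)
    (q : C) (q_neq0 : q != 0) (q_not_root : forall m, (0 < m)%N -> q ^+ m != 1)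
    (d_gt0 : forall i, (0 < d i)%N) (A : algType C) (X : 'I_n -> A) i j :
  a i j = 0 -> serre_rel a d q X i j -> X i * X j = X j * X i.
Proof.
move=> aij; rewrite /serre_rel aij subr0 /= !big_ord_recl big_ord0 /=.
have qi0 := qi_neq0 d q_neq0 i; have nr := @qi_not_root _ _ _ _ q_not_root d_gt0 i.
rewrite !mul1r !mulr1 addr0.
rewrite /bump /= addn0 subn0 !expr1 qbinom0 // qbinomnn //.
by rewrite mulr1 scale1r scaleN1r => /eqP; rewrite subr_eq0 => /eqP.
Qed.

Theorem theorem2p5 (R : realType) (n : nat) (a : 'M[int]_n) (d : 'I_n -> nat)
    (hcartan : cartan_datum a d R)
    (q : R[i]) (q_neq0 : q != 0)
    (q_not_root : forall m : nat, (0 < m)%N -> q ^+ m != 1)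
    (U : algType R[i]) (E F K K' : 'I_n -> U) (hU : is_Uq a d q E F K K')
    (S : {set 'I_n})
    (hS : forall i j, i \in S -> j \in S -> i != j -> a i j = 0) :
  let U0 := Uweight a d q K K' 0 in
  let U0g := Uzero a d q E F K K' in
  let U0S := UzeroS a d q E F K K' S in
  let IS := IdealS a d q E F K K' S in
  [/\ direct_sum2 U0 U0S IS,
      direct (QplusS S) U0g
    & direct (@Qplus n `\` QplusS S) U0g] /\
  [/\ subalgebra_of U0 U0S,
      forall x y, U0S x -> U0S y -> x * y = y * x
    & U0S = subalg_gen ([set E i * F i | i in [set i | i \in S]]
                          `|` (range K `|` range K'))] /\
  two_sided_ideal_of U0 IS.
Proof.
have d_gt0 := cartan_d_gt0 hcartan; have a_sym := cartan_sym hcartan.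
have nondeg := root_form_nondeg hcartan.
have [rKV rKK rKE rKF rEF rSE rSF] := Uq_rel hU.
have rel : nonserre_relations a d q E F K K' by split.
have gen := Uq_generated hU.
have tproj := triangular_projection q_neq0 q_not_root (cartan_diag hcartan)
  (cartan_offdiag hcartan) d_gt0 a_sym rel rSF hU.
have comm_S (X : 'I_n -> U) : (forall i j, i != j -> serre_rel a d q X i j) ->
    forall i j, i \in S -> j \in S -> X i * X j = X j * X i.
  move=> SX i j iS jS; have [->//|ij] := eqVneq i j.
  exact: (serre_comm_of_zero q_neq0 q_not_root d_gt0 (hS i j iS jS ij) (SX i j ij)).
have EE := comm_S E rSE; have FF := comm_S F rSF.
have U0E := weight0_tri q_neq0 q_not_root nondeg rel gen.
have sumE := sumsp_tri q_neq0 q_not_root nondeg rel.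
move=> U0 U0g IS_ IS.
have U0SE : IS_ = tri E F K K' (fun h1 h2 => h1 = h2 /\ QplusS S h1) by apply: sumE.
have ISE : IS = tri E F K K'
    (fun h1 h2 => h1 = h2 /\ (@Qplus n `\` QplusS S) h1) by apply: sumE.
have sub0 (P : 'rV[int]_n -> 'rV[int]_n -> Prop) :
    (forall g h, P g h -> g = h) -> tri E F K K' P `<=` U0.
  by move=> Pgh; rewrite /U0 U0E; apply: tri_sub => v w /Pgh.
have U0S_sub : IS_ `<=` U0 by rewrite U0SE; apply: sub0 => g h [].
have IS_sub : IS `<=` U0 by rewrite ISE; apply: sub0 => g h [].
have U0SG : IS_ = subalg_gen (EFK E F K K' S).
  by rewrite U0SE; apply: (triS_EFK q_neq0 rel EE FF).
split; [split|split; [split|]].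
- split; last first.
    apply/seteqP; split=> [x|x ->]; last by split; [rewrite U0SE|rewrite ISE]; apply: lspan0.
    rewrite U0SE ISE => -[xS xI]; apply: (tri_inter0 tproj) xS xI.
    by move=> g1 g2 h [-> hS1] [-> []].
  apply/seteqP; split; last first.
    apply: lspan_sub; first exact: Uweight_subspace.
    by move=> x [/U0S_sub|/IS_sub].
  rewrite /U0 U0E; apply: lspan_sub; first exact: lspan_subspace.
  move=> _ [v [u [w [vw u0 ->]]]]; apply: sub_lspan.
  have [vS|vS] := pselect (QplusS S (content v)).
    by left; rewrite U0SE; apply: tri_gen.
  right; rewrite ISE; apply: tri_gen => //; split=> //; split=> //.
  exact: content_Qplus.
- exact: (Uzero_direct q_neq0 q_not_root nondeg rel tproj).
- exact: (Uzero_direct q_neq0 q_not_root nondeg rel tproj).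
- split=> //; apply/subalg_closedP; rewrite U0SG.
  by split; [exact: subalg_gen_subspace|exact: subalg_gen_submonoid].
- rewrite U0SG; apply: subalg_gen_comm; exact: (EFK_comm q_neq0 rel EE FF).
- exact: U0SG.
split=> //; first by rewrite ISE; apply/submod_closedP; apply: tri_subspace.
(* The lower bounds on the degrees in a product: a letter outside S in one of the
   factors survives. *)
have bound (g h : 'rV[int]_n) : Qplus g -> Qplus h -> ~ QplusS S g \/ ~ QplusS S h ->
    forall k : 'rV[int]_n, Qplus k -> (forall i, [/\ g 0 i <= k 0 i, h 0 i <= k 0 i
      & k 0 i <= g 0 i + h 0 i]) -> ~ QplusS S k.
  move=> g0 h0 gh k k0 le [_ kS]; case: gh => gS; apply: gS; split=> // i iS.
    by have [lei _ _] := le i; apply/eqP; rewrite eq_le g0 -(kS i iS) lei.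
  by have [_ lei _] := le i; apply/eqP; rewrite eq_le h0 -(kS i iS) lei.
have mul_bound v u w v' u' w' : content v = content w -> content v' = content w' ->
    Ucartan K K' u -> Ucartan K K' u' ->
    ~ QplusS S (content v) \/ ~ QplusS S (content v') ->
    IS (monE E v * u * monF F w * (monE E v' * u' * monF F w')).
  move=> vw vw' u0 u0' nS.
  have t1 : tri E F K K' (fun h1 h2 => h1 = content v /\ h2 = content v)
    (monE E v * u * monF F w) by apply: tri_gen.
  have t2 : tri E F K K' (fun h1 h2 => h1 = content v' /\ h2 = content v')
    (monE E v' * u' * monF F w') by apply: tri_gen.
  rewrite ISE; apply: tri_sub (tri_mul q_neq0 rel t1 t2) => v1 w1 [-> le].
  split=> //; split; first exact: content_Qplus.
  by apply: bound le => //; apply: content_Qplus.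
have ISS : subspace IS by rewrite ISE; apply: tri_subspace.
move=> w x; rewrite /U0 U0E ISE => w0 xI; split.
  rewrite -ISE; apply: (lspan_mul ISS) w0 xI.
  move=> _ _ [v [u [w1 [vw u0 ->]]]] [v' [u' [w' [[vw' [_ nS]] u0' ->]]]].
  by apply: mul_bound => //; right.
rewrite -ISE; apply: (lspan_mul ISS) xI w0.
move=> _ _ [v [u [w1 [[vw [_ nS]] u0 ->]]]] [v' [u' [w' [vw' u0' ->]]]].
by apply: mul_bound => //; left.
Qed.
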